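(* Let $\nu>-1$ and $n\in\mathbb{N}$, $n\ge1$. Let $P_n^\nu(x)=\sum_{k=0}^n a_{n,k}x^k$ be the orthonormal polynomial of degree $n$ with positive leading coefficient for the weight $e^{-x}\rho_\nu(x)$ on $(0,\infty)$, i.e. $\int_0^\infty P_m^\nu(x)P_n^\nu(x)e^{-x}\rho_\nu(x)\,dx=\delta_{n,m}$. Then for $x>0$ the following Rodrigues-type formula holds: $$P_n^\nu(x)=\frac{(-1)^{n+1}a_{n,0}}{D_n\,n}\sum_{r=0}^nD_{n,r}\,r!\,(1+\nu)_r\sum_{k=0}^{2r}\frac1{k!}\;{}_3F_2(-k,\,1+\nu+r,\,1+r;\,1+\nu,\,1;\,1)\;\frac{e^x}{\rho_\nu(x)}\frac{d^n}{dx^n}\left[e^{-x}\frac{d^k}{dx^k}\left(e^x\,I_-^n\{y^ke^{-y}\rho_\nu(y)\}(x)\right)\right],$$ where $a_{n,0}$ is given by $$a_{n,0}=\pm D_n\left[\frac{\Gamma(1+\nu)}{D_{n,n}\sum_{k=0}^nD_{n,k}(n+k)!\,d_{0,n+k}}\right]^{1/2}$$ (with the sign chosen so that the leading coefficient $a_{n,n}$ is positive), and $D_n$, $D_{n,r}$, $d_{k,m}$, $I_-^n$ are defined in the context.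
   Context: $\rho_\nu(x)=2x^{\nu/2}K_\nu(2\sqrt x)=\int_0^\infty t^{\nu-1}e^{-t-x/t}\,dt$ for $x>0$, $\nu\in\mathbb{R}$, where $K_\nu$ is the modified Bessel function. $I_-^n$ is the Riemann–Liouville integral $(I_-^nf)(x)=\frac1{\Gamma(n)}\int_x^\infty(y-x)^{n-1}f(y)\,dy$. ${}_3F_2$ is the (here terminating) generalized hypergeometric series; $(a)_k$ is the Pochhammer symbol. $\Psi(a,b;z)$ is the Tricomi confluent hypergeometric function, $\Psi(a,b;z)=\frac1{\Gamma(a)}\int_0^\infty e^{-zt}t^{a-1}(1+t)^{b-a-1}dt$ for $a,z>0$. For $k,m\in\mathbb{N}_0$, $$d_{k,m}=\Gamma(1+\nu)\sum_{r=0}^k(-1)^{k+r}\binom{k}{r}\frac{(1+\nu)_k}{(1+\nu)_r}\,\Gamma(1+\nu+k+r+m)\,\Psi(1+m,\,1-\nu-k-r;\,1).$$ $D_n$ is the determinant of the $n\times n$ matrix whose entry in row $m$ ($m=0,\dots,n-1$) and column $j$ ($j=1,\dots,n$) is $d_{j,m}$. For $1\le k\le n$, $D_{n,k}$ is the determinant obtained from $D_n$ by replacing its column $j=k$ by the column $(d_{0,0},d_{0,1},\dots,d_{0,n-1})^T$; and $D_{n,0}:=-D_n$.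
   Formalization: The factor 1/n in the prefactor is dropped: the formula is proved with (-1)^{n+1} a_{n,0}/D_n in place of (-1)^{n+1} a_{n,0}/(D_n n), since with the stated I_-^n the printed right-hand side equals P_n(x)/n and is false for every n ≥ 2. *)

(* Defs.v *)
(* MathComp-Analysis, over an arbitrary R : realType. *)
From HB Require Import structures.
From mathcomp Require Import all_boot all_order all_algebra.
From mathcomp Require Import all_classical all_reals all_analysis.
Set Implicit Arguments.
Unset Strict Implicit.
Unset Printing Implicit Defensive.
Import Order.TTheory GRing.Theory Num.Theory.
Import numFieldNormedType.Exports.
Local Open Scope classical_set_scope.
Local Open Scope ring_scope.

(* Integrals below are real-valued Lebesgue integrals. *)

Definition Gamma (R : realType) (a : R) : R :=
  \int[@lebesgue_measure R]_(t in `]0, +oo[) (t `^ (a - 1) * expR (- t)).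

(* The Pochhammer symbol (a)_k. *)
Definition pochhammer (R : realType) (a : R) (k : nat) : R :=
  \prod_(i < k) (a + i%:R).

(* The generalized hypergeometric series 3F2(a1, a2, a3; b1, b2; z). *)
Definition hyper3F2 (R : realType) (a1 a2 a3 b1 b2 z : R) : R :=
  limn (series (fun j : nat =>
    pochhammer a1 j * pochhammer a2 j * pochhammer a3 j /
    (pochhammer b1 j * pochhammer b2 j) * (z ^+ j / j`!%:R))).

(* The Tricomi function Psi(a, b; z), by its integral representation, which is
   meaningful for a, z > 0. *)
Definition tricomi (R : realType) (a b z : R) : R :=
  (Gamma a)^-1 *
  \int[@lebesgue_measure R]_(t in `]0, +oo[)
    (expR (- (z * t)) * t `^ (a - 1) * (1 + t) `^ (b - a - 1)).

(* rho nu x = 2 x^(nu/2) K_nu(2 sqrt x) for x > 0, K_nu being the modified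
   Bessel (Macdonald) function. *)
Definition rho (R : realType) (nu x : R) : R :=
  \int[@lebesgue_measure R]_(t in `]0, +oo[)
    (t `^ (nu - 1) * expR (- t - x / t)).

(* The right-sided Riemann-Liouville integral of integer order n >= 1. *)
Definition RLint (R : realType) (n : nat) (f : R -> R) (x : R) : R :=
  (Gamma n%:R)^-1 *
  \int[@lebesgue_measure R]_(y in `[x, +oo[) ((y - x) ^+ n.-1 * f y).

Definition orthonormal_polys (R : realType) (w : R -> R) (P : nat -> {poly R})
    : Prop :=
  (forall m, size (P m) = m.+1 /\ 0 < lead_coef (P m)) /\
  (forall m n, \int[@lebesgue_measure R]_(x in `]0, +oo[)
      ((P m).[x] * (P n).[x] * w x) = (m == n)%:R).

Definition dcoef (R : realType) (nu : R) (k m : nat) : R :=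
  Gamma (1 + nu) *
  \sum_(r < k.+1) (-1) ^+ (k + r) * 'C(k, r)%:R *
    (pochhammer (1 + nu) k / pochhammer (1 + nu) r) *
    Gamma (1 + nu + (k + r + m)%:R) *
    tricomi (1 + m%:R) (1 - nu - k%:R - r%:R) 1.

(* Columns are numbered 1, ..., n in the mathematics and 0, ..., n - 1 in
   'I_n: column j of the matrix holds d_(j+1, m). *)
Definition Ddet (R : realType) (nu : R) (n : nat) : R :=
  \det (\matrix_(m < n, j < n) dcoef nu j.+1 m).

(* For 1 <= k <= n, column k is replaced by (d_(0,m))_m. *)
Definition Ddet_repl (R : realType) (nu : R) (n k : nat) : R :=
  if k == 0%N then - Ddet nu n
  else \det (\matrix_(m < n, j < n)
               dcoef nu (if j.+1 == k then 0%N else j.+1) m).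

(* With the normalization 1/Gamma(n) of I_-^n one has D^n I_-^n f = (-1)^n f, so
   this equals (-1)^n (1 / rho(x)) d^k/dx^k (x^k rho(x)).  Hence the Rodrigues
   formula holds with prefactor (-1)^(n+1) a_(n,0) / D_n; the additional 1/n
   found in its printed form is a misprint (invisible for n = 1). *)
Definition rodrigues_term (R : realType) (nu : R) (n k : nat) (x : R) : R :=
  expR x / rho nu x *
  derive1n n (fun u : R => expR (- u) *
    derive1n k (fun v : R => expR v *
      RLint n (fun y : R => y ^+ k * expR (- y) * rho nu y) v) u) x.

(* Main.v *)
Require Import Defs.
From HB Require Import structures.
From mathcomp Require Import all_boot all_order all_algebra.
From mathcomp Require Import all_classical all_reals all_analysis.
From mathcomp Require Import measurable_realfun ring lra zify.
Set Implicit Arguments.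
Unset Strict Implicit.
Unset Printing Implicit Defensive.
Import Order.TTheory GRing.Theory Num.Theory.
Import numFieldNormedType.Exports.
Local Open Scope classical_set_scope.
Local Open Scope ring_scope.

(* Differentiating a rescaled integral with respect to the scale gives
     rho_(mu+1) = mu rho_mu + x rho_(mu-1),
   hence x^k rho_nu is an explicit combination of the rho_(nu+k+r), r <= k.
   By Tonelli's theorem the moments of e^(-x) rho_mu(x) are values of Psi, and
   the two facts together say that d_(k,m) is Gamma(1+nu)/m! times the moment of
   order k+m of e^(-x) rho_nu(x).  Orthogonality of P_n to x^m for m < n is then
   a linear system in the a_(n,k), solved by Cramer's rule; D_n <> 0 because
   x e^(-x) rho_nu(x) is positive, and a_(n,0) comes from the norm of P_n.

   Since D^n I_-^n = (-1)^n and e^(-x) D^k e^x = (1+D)^k commutes with D^n, the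
   bracket in the Rodrigues formula is (-1)^n e^(-x) D^k (x^k rho_nu).  It
   remains to expand x^r rho_nu in the functions D^k (x^k rho_nu) / k!.  As
   theta = x d/dx satisfies theta (theta - nu) rho_nu = x rho_nu, multiplication
   by x^r acts on rho_nu as the polynomial (s)_r (s+nu)_r in s = - theta, and the
   wanted coefficients are its Newton differences at s = 1, 2, ...; these are
   the 3F2 values. *)

(** * Binomial transforms *)

(** With E the shift g(j) -> g(j+1), this is ((1 - E)^k g)(0), a Newton difference up to sign. The
    lemmas below translate shifts and multiplication by j into operations on k. *)
Definition bintr (R : pzRingType) (g : nat -> R) (k : nat) : R :=
  \sum_(j < k.+1) (-1) ^+ j * 'C(k, j)%:R * g j.

Section BinomialTransform.
Context {R : comNzRingType}.
Implicit Types (g : nat -> R) (a : R) (k N : nat).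

Lemma eq_bintr g1 g2 : g1 =1 g2 -> bintr g1 =1 bintr g2.
Proof. by move=> eg k; apply: eq_bigr => j _; rewrite eg. Qed.

Lemma bintrD g1 g2 k : bintr (fun j => g1 j + g2 j) k = bintr g1 k + bintr g2 k.
Proof. by rewrite /bintr -big_split/=; apply: eq_bigr => j _; rewrite mulrDr. Qed.

Lemma bintrZ a g k : bintr (fun j => a * g j) k = a * bintr g k.
Proof. by rewrite /bintr mulr_sumr; apply: eq_bigr => j _; ring. Qed.

Lemma bintr_widen g k N : (k < N)%N ->
  \sum_(j < N) (-1) ^+ j * 'C(k, j)%:R * g j = bintr g k.
Proof.
move=> kN; rewrite /bintr (@big_ord_widen _ _ _ k.+1 N (fun j => (-1) ^+ j * 'C(k, j)%:R * g j))//.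
rewrite [RHS]big_mkcond/=; apply: eq_bigr => j _.
by case: ltnP => // kj; rewrite bin_small ?mulr0 ?mul0r.
Qed.

(** Pascal's rule, that is, E = 1 - (1 - E). *)
Lemma bintr_shift g k : bintr (fun j => g j.+1) k = bintr g k - bintr g k.+1.
Proof.
rewrite -(@bintr_widen g k k.+2)// /bintr [X in X - _]big_ord_recl [X in _ - X]big_ord_recl.
rewrite !bin0 opprD addrACA subrr add0r -sumrB; apply: eq_bigr => j _.
by rewrite /bump/= ?add1n binS natrD exprS; ring.
Qed.

(** From (k+1) C(k,j) = (j+1) C(k+1,j+1). At k = 0 the factor k cancels the conventional predecessor
    of zero. *)
Lemma bintr_mul g k :
  bintr (fun j => j%:R * g j) k = k%:R * (bintr g k - bintr g k.-1).
Proof.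
case: k => [|k]; first by rewrite /bintr big_ord1 mul0r !mul0r mulr0.
rewrite /= -(@bintr_widen g k k.+2)// /bintr -sumrB mulr_sumr.
apply: eq_bigr => -[[|j] jk] _ /=; first by rewrite !bin0; ring.
have : (k.+1%:R * 'C(k, j)%:R : R) = j.+1%:R * 'C(k.+1, j.+1)%:R.
  by rewrite -!natrM mul_bin_diag.
rewrite binS natrD => e.
have -> : (-1) ^+ j.+1 * ('C(k, j.+1)%:R + 'C(k, j)%:R) * (j.+1%:R * g j.+1)
    = (-1) ^+ j.+1 * (j.+1%:R * ('C(k, j.+1)%:R + 'C(k, j)%:R)) * g j.+1 by ring.
by rewrite -e; ring.
Qed.

Lemma bintr_mulD a g k : bintr (fun j => (a + j%:R) * g j) k =
  (a + k%:R) * bintr g k - k%:R * bintr g k.-1.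
Proof.
rewrite (eq_bintr (g2 := fun j => a * g j + j%:R * g j)); last first.
  by move=> j; ring.
by rewrite bintrD bintrZ bintr_mul; ring.
Qed.

(** Summation by parts. This lemma and [sum_mulD] move recurrences in k from the coefficients to the
    functions, at the price of a boundary term. *)
Lemma sum_shift (b Y : nat -> R) N :
  \sum_(k < N.+1) (b k - b k.+1) * Y k =
  \sum_(k < N.+1) b k * (Y k - (0 < k)%:R * Y k.-1) - b N.+1 * Y N.
Proof.
elim: N => [|N IH]; first by rewrite !big_ord1 /=; ring.
by rewrite big_ord_recr IH [in RHS]big_ord_recr/=; ring.
Qed.

Lemma sum_mulD a (c Z : nat -> R) N :
  \sum_(k < N) ((a + k%:R) * c k - k%:R * c k.-1) * Z k =
  \sum_(k < N) c k * ((a + k%:R) * Z k - k.+1%:R * Z k.+1) + N%:R * c N.-1 * Z N.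
Proof.
elim: N => [|N IH]; first by rewrite !big_ord0; ring.
by rewrite big_ord_recr IH [in RHS]big_ord_recr/= -[N.+1]addn1 natrD; ring.
Qed.

End BinomialTransform.

(* Here [g j] stands for [x ^+ j * rho (nu - j%:R) x / j`!%:R], so that
   [bintr g k] is the k-th derivative of x^k rho_nu(x), divided by k!. *)
Section BesselExpansion.
Context {R : realType} (nu x : R) (g : nat -> R).
Hypothesis gE : forall j, x * g j =
  (nu - j%:R - 1) * j.+1%:R * g j.+1 + j.+1%:R * j.+2%:R * g j.+2.

Let W := bintr g.
(** In the intended reading x W_k' = (k+1)(W_{k+1} - W_k). So with theta = x d/dx, [A k] is - theta
    W_k and [C k] is theta (theta - nu) W_k. *)
Let A k := (1 + k%:R) * W k - k.+1%:R * W k.+1.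
Let C k := (1 + nu + k%:R) * A k - k.+1%:R * A k.+1.

Let AE k : A k = - bintr (fun j => j%:R * g j) k.+1.
Proof. by rewrite bintr_mul /A/= -[k.+1]addn1 natrD /W; ring. Qed.

Let h j := j.+1%:R * g j.+1.

Let AB k : A k - A k.+1 = - bintr h k.+1.
Proof. by rewrite !AE (bintr_shift (fun j => j%:R * g j)); ring. Qed.

(** The case k = 0 is the equation theta (theta - nu) rho_nu = x rho_nu. In general this is the
    binomial transform of [gE], with its right side written in terms of [h]. *)
Let CE k : C k - (0 < k)%:R * C k.-1 = x * W k.
Proof.
rewrite -bintrZ (eq_bintr (g2 := fun j => j.+1%:R * h j.+1 + (nu - 1) * h j + (-1) * (j%:R * h j))); last first.
  by move=> j; rewrite gE /h; ring.
rewrite !(bintrD, bintrZ) (bintr_shift (fun j => j%:R * h j)).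
have CA i : C i = i.+1%:R * (A i - A i.+1) + nu * A i.
  by rewrite /C -[i.+1]addn1 natrD; ring.
have eh : bintr h k = A k + k%:R * (bintr g k - bintr g k.-1).
  by rewrite /h (bintr_shift (fun j => j%:R * g j)) AE bintr_mul; ring.
rewrite CA AB (@bintr_mul _ h k.+1) /=.
case: k eh => [|k] /= eh; first by rewrite eh; ring.
rewrite CA AB.
have -> : A k.+1 = A k + bintr h k.+1 by rewrite -[A k.+1](subKr (A k)) AB; ring.
by rewrite -[k.+2]addn1 natrD; ring.
Qed.

(** Newton differences of (s)_r (s+nu)_r at s = 1, 2, .... Then [c] belongs to the values from s = 2
    on, and [d] to those values times 1 + nu + j. *)
Let b r := bintr (fun j => pochhammer (1 + j%:R) r * pochhammer (1 + nu + j%:R) r).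
Let c r k := b r k - b r k.+1.
Let d r k := (1 + nu + k%:R) * c r k - k%:R * c r k.-1.

Let b0 k : b 0 k.+1 = 0.
Proof.
have e j : pochhammer (1 + j%:R) 0 * pochhammer (1 + nu + j%:R) 0 = 1 :> R.
  by rewrite /pochhammer !big_ord0 mulr1.
rewrite /b (eq_bintr (g2 := fun=> 1))//.
by have /eqP := @bintr_shift R (fun=> 1) k; rewrite eq_sym subr_eq addrC -subr_eq subrr => /eqP.
Qed.

(** The first factor is peeled off both symbols: (1+j)_{r+1} = (1+j) (2+j)_r, and likewise with
    nu. *)
Let bS r k : b r.+1 k = (1 + k%:R) * d r k - k%:R * d r k.-1.
Proof.
rewrite /d /c /b -!bintr_shift -!bintr_mulD; apply: eq_bintr => j.
rewrite /pochhammer 2!big_ord_recl /= !addr0.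
have e a : \prod_(i < r) (a + j%:R + (bump 0 i)%:R) = \prod_(i < r) (a + j.+1%:R + i%:R) :> R.
  by apply: eq_bigr => i _; rewrite /bump/= natrD -[j.+1]addn1 natrD; ring.
by rewrite !e; ring.
Qed.

(** Differences of order above the degree 2r vanish; in [bS] the order can grow by at most two at
    each step. *)
Let b_eq0 r k : (2 * r < k)%N -> b r k = 0.
Proof.
elim: r k => [|r IH] k; first by case: k => // k _; exact: b0.
case: k => [//|[//|k]] rk; rewrite bS /d /c/= !IH; [ring|lia..].
Qed.

Lemma sum_bintr_pochhammer r N : (2 * r < N)%N ->
  \sum_(k < N) bintr (fun j => pochhammer (1 + j%:R) r *
     pochhammer (1 + nu + j%:R) r) k * bintr g k = x ^+ r * g 0.
Proof.
rewrite -/(b r); elim: r N => [|r IH] N.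
  case: N => // N _; rewrite big_ord_recl big1 => [|i _]; last by rewrite b0 mul0r.
  by rewrite /b /bintr !big_ord1 bin0 /pochhammer !big_ord0; ring.
case: N => [//|[//|N]] rN.
(* Three summations by parts turn W into A, then C, then C_k - C_{k-1} = x W_k. The boundary terms
   involve [b r] beyond index 2r and vanish. *)
under eq_bigr do rewrite bS.
rewrite (sum_mulD 1 (d r)).
rewrite (sum_mulD (1 + nu) (c r) (fun k => (1 + k%:R) * W k - k.+1%:R * W k.+1)).
rewrite (sum_shift (b r) C).
under eq_bigr do rewrite CE mulrCA.
rewrite -mulr_sumr IH ?exprS; last by lia.
rewrite /d /c !(@b_eq0 r); [ring|lia..].
Qed.

End BesselExpansion.

(* [f j] stands for [rho (nu + j) x], whose three-term recurrence is the
   hypothesis. *)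
Lemma three_term_expansion (R : realType) (nu x : R) (f : nat -> R) (k : nat) :
  -1 < nu ->
  (forall j, x * f j = f j.+2 - (nu + j.+1%:R) * f j.+1) ->
  \sum_(r < k.+1) (-1) ^+ (k + r) * 'C(k, r)%:R *
    (pochhammer (1 + nu) k / pochhammer (1 + nu) r) * f (k + r)%N = x ^+ k * f 0.
Proof.
move=> nu1 fE.
have p0 r : pochhammer (1 + nu) r != 0.
  by apply/prodf_neq0 => i _; rewrite gt_eqF//; have := ler0n R i; lra.
have pS r : pochhammer (1 + nu) r.+1 = pochhammer (1 + nu) r * (1 + nu + r%:R).
  by rewrite /pochhammer big_ord_recr.
elim: k => [|k IH].
  by rewrite big_ord1 bin0 expr0 divff//; ring.
rewrite exprS -mulrA -IH mulr_sumr.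
pose c r : R := (-1) ^+ (k + r) * 'C(k, r)%:R * (pochhammer (1 + nu) k / pochhammer (1 + nu) r).
transitivity (\sum_(r < k.+1) (c r * f (k + r).+2 - c r * (nu + (k + r).+1%:R) * f (k + r).+1)); last first.
  by apply: eq_bigr => r _; rewrite -/(c r) mulrCA fE; ring.
rewrite sumrB.
(* The factor [(0 < r)%:R] lets the reindexed first sum start at r = 0; in the second sum the added
   term contains C(k,k+1) = 0. *)
transitivity (\sum_(r < k.+2) (0 < r)%:R * c r.-1 * f (k + r).+1 - 
  \sum_(r < k.+2) c r * (nu + (k + r).+1%:R) * f (k + r).+1); last first.
  congr (_ - _).
    rewrite big_ord_recl /= !mul0r add0r; apply: eq_bigr => r _ /=.
    by rewrite /bump/= add1n addnS; ring.
  by rewrite big_ord_recr/= [X in _ + X](_ : _ = 0) ?addr0// /c bin_small//; ring.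
rewrite -sumrB; apply: eq_bigr => r _; rewrite addSn -mulrBl; congr (_ * _).
case: r => -[|r] rk /=.
  rewrite /c !bin0 pS ?addSn ?addn0 [pochhammer _ 0]big_ord0 exprS -addn1 natrD.
  by ring.
have er : ((k%:R - r%:R) * 'C(k, r)%:R : R) = r.+1%:R * 'C(k, r.+1)%:R.
  by rewrite -natrB -?natrM ?mul_bin_left//; lia.
rewrite /c !addnS !exprS !pS binS !natrD.
have pr0 := p0 r; have := p0 r.+1; rewrite pS mulf_eq0 negb_or => /andP[_ nr0].
set p := pochhammer _ k; set q := pochhammer _ r.
(* All ratios are multiples of u = (1+nu)_k / (1+nu)_{r+1}. The difference of the two sides is then
   a multiple of (k-r) C(k,r) - (r+1) C(k,r+1), which is zero by [er]. *)
pose u := p / q / (1 + nu + r%:R).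
have -> : p * (1 + nu + k%:R) / (q * (1 + nu + r%:R)) = u * (1 + nu + k%:R).
  by rewrite /u invfM; ring.
have -> : p / (q * (1 + nu + r%:R)) = u by rewrite /u invfM; ring.
have -> : p / q = u * (1 + nu + r%:R) by rewrite /u mulfVK.
clearbody u.
move: er; set C1 : R := 'C(k, r)%:R; set C2 : R := 'C(k, r.+1)%:R.
rewrite -[(k + r).+2]addn1 -[(k + r).+1]addn1 -[r.+1]addn1 !natrD => er.
apply/eqP; rewrite -subr_eq0 (_ : _ - _ =
  (-1) ^+ (k + r) * u * ((k%:R - r%:R) * C1 - (r%:R + 1) * C2)); last first.
  by ring.
by rewrite er subrr mulr0.
Qed.

(** * Pochhammer symbols and the terminating 3F2 *)

Section Pochhammer.
Context {R : realType}.
Implicit Types (a : R) (j k r : nat).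

Lemma pochhammerD a j k :
  pochhammer a (j + k) = pochhammer a j * pochhammer (a + j%:R) k.
Proof.
rewrite /pochhammer big_split_ord/=; congr (_ * _).
by apply: eq_bigr => i _; rewrite natrD addrA.
Qed.

Lemma pochhammer1 j : pochhammer (1 : R) j = j`!%:R.
Proof.
elim: j => [|j IH]; first by rewrite /pochhammer big_ord0.
by rewrite /pochhammer big_ord_recr/= -/(pochhammer _ _) IH factS natrM -natr1; ring.
Qed.

Lemma pochhammerN k j :
  pochhammer (- k%:R : R) j = (-1) ^+ j * 'C(k, j)%:R * j`!%:R.
Proof.
rewrite -mulrA -natrM bin_ffact; elim: j => [|j IH].
  by rewrite /pochhammer big_ord0 expr0 mul1r.
rewrite /pochhammer big_ord_recr/= -/(pochhammer _ _) IH ffactnSr natrM exprS.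
have [jk|kj] := leqP j k; first by rewrite natrB//; ring.
by rewrite ffact_small//; ring.
Qed.

Lemma pochhammer_gt0 a j : 0 < a -> 0 < pochhammer a j.
Proof. by move=> a0; apply: prodr_gt0 => i _; rewrite ltr_wpDr. Qed.

(** The series terminates because (-k)_j = (-1)^j C(k,j) j!. The identity (a)_j (a+j)_r = (a)_r
    (a+r)_j, for a = 1 and a = 1 + nu, exchanges the roles of j and r. *)
Lemma hyper3F2_bintr (nu : R) k r : -1 < nu ->
  r`!%:R * pochhammer (1 + nu) r *
    hyper3F2 (- k%:R) (1 + nu + r%:R) (1 + r%:R) (1 + nu) 1 1 =
  bintr (fun j => pochhammer (1 + j%:R) r * pochhammer (1 + nu + j%:R) r) k.
Proof.
move=> nu1; have nu0 : 0 < 1 + nu by lra.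
rewrite /hyper3F2; set u := (X in series X).
have -> : limn (series u) = \sum_(j < k.+1) u j.
  apply: cvg_lim => //; apply: cvg_near_cst; near=> n.
  have kn : (k < n)%N by near: n; exact: nbhs_infty_gt.
  rewrite /series/= -(big_mkord xpredT u) (big_cat_nat (n := k.+1))//=.
  rewrite big_mkord [X in _ + X](_ : _ = 0) ?addr0//.
  rewrite big_nat_cond big1// => j /andP[/andP[kj _] _].
  by rewrite /u pochhammerN bin_small//; ring.
rewrite mulr_sumr; apply: eq_bigr => j _.
have p0 : pochhammer (1 + nu) j != 0 by rewrite gt_eqF// pochhammer_gt0.
have f0 : (j`!%:R : R) != 0 by rewrite pnatr_eq0 -lt0n fact_gt0.
have e a : pochhammer a j * pochhammer (a + j%:R) r = pochhammer a r * pochhammer (a + r%:R) j.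
  by rewrite -!pochhammerD addnC.
have e1 := e (1 + nu); have e2 := e 1; rewrite !pochhammer1 in e2.
rewrite /u pochhammerN expr1n div1r pochhammer1.
have -> : pochhammer (1 + nu + j%:R) r = pochhammer (1 + nu) r * pochhammer (1 + nu + r%:R) j / pochhammer (1 + nu) j.
  by rewrite -e1 mulrC mulKf.
have -> : pochhammer (1 + j%:R : R) r = r`!%:R * pochhammer (1 + r%:R) j / j`!%:R.
  by rewrite -e2 mulrC mulKf.
rewrite invfM; set P := pochhammer _ j in p0 *; set F := j`!%:R in f0 *.
transitivity ((-1) ^+ j * 'C(k, j)%:R * (F / F) * (r`!%:R * pochhammer (1 + r%:R) j / F * (pochhammer (1 + nu) r * pochhammer (1 + nu + r%:R) j / P))); first by ring.
by rewrite divff// mulr1.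
Unshelve. all: by end_near. Qed.

End Pochhammer.

(** * Integration over the half-line *)

Section HalfLine.
Context {R : realType}.
Local Notation mu := (@lebesgue_measure R).
Local Notation H := (`]0, +oo[%classic : set R).

Let mH : measurable H. Proof. exact: measurable_itv. Qed.
Hint Resolve mH : core.

Let HP (x : R) : H x = (0 < x) :> Prop.
Proof. by rewrite /= in_itv/= andbT. Qed.

(** The image of Lebesgue measure under division-free scaling x -> c x, multiplied by c, agrees with
    Lebesgue measure on half-open intervals and hence everywhere. *)
Lemma ge0_integral_scale (c : R) (f : R -> \bar R) : 0 < c ->
  measurable_fun H f -> (forall x, 0 < x -> (0 <= f x)%E) ->
  (\int[mu]_(x in H) f x = c%:E * \int[mu]_(x in H) f (c * x)%R)%E.
Proof.
move=> c0 mf f0.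
have mc : measurable_fun [set: measurableTypeR R] ( *%R c).
  exact: mulrl_measurable.
have @p : {measure set (measurableTypeR R) -> \bar R}.
  refine (pushforward mu (( *%R c) : measurableTypeR R -> measurableTypeR R)).
  exact: mc.
pose m' := mscale (NngNum (ltW c0)) p.
rewrite (eq_measure_integral m'); last first.
  move=> A mA _; apply: lebesgue_measure_unique => //= _ [[a b] _ <-]/=.
  rewrite /mscale/= /pushforward/=.
  have -> : ( *%R c) @^-1` `]a, b] = `](a / c), (b / c)]%classic.
    by apply/seteqP; split => x /=; rewrite !in_itv/= ltr_pdivrMr// ler_pdivlMr// mulrC.
  rewrite !lebesgue_measure_itv/= !lte_fin ltr_pM2r ?invr_gt0//.
  case: ifPn => _; last by rewrite mule0.
  by rewrite -!EFinD -EFinM; congr EFin; rewrite mulrBr !mulrA ![c * _]mulrC !mulfK ?gt_eqF.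
rewrite ge0_integral_mscale//; last by move=> x; rewrite HP; exact: f0.
rewrite ge0_integral_pushforward//; last first.
  by move=> x; rewrite inE HP; exact: f0.
congr (_ * integral _ _ _)%E.
by apply/seteqP; split => x /=; rewrite !in_itv/= !andbT pmulr_rgt0.
Qed.

End HalfLine.

Section HalfLineIntegrals.
Context {R : realType}.
Local Notation mu := (@lebesgue_measure R).
Local Notation H := (`]0, +oo[%classic : set R).
Implicit Types f F : R -> R.

Let mH : measurable H. Proof. exact: measurable_itv. Qed.
Hint Resolve mH : core.

Let HP (x : R) : H x = (0 < x) :> Prop.
Proof. by rewrite /= in_itv/= andbT. Qed.

Lemma integrable_ge0_halfline f : measurable_fun H f ->
  (forall x, 0 < x -> 0 <= f x) -> (\int[mu]_(x in H) (f x)%:E < +oo)%E ->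
  mu.-integrable H (EFin \o f).
Proof.
move=> mf f0 foo; apply/integrableP; split; first exact/measurable_EFinP.
rewrite (_ : integral _ _ _ = \int[mu]_(x in H) (f x)%:E)%E//.
by apply: eq_integral => x; rewrite inE HP => x0 /=; rewrite ger0_norm// f0.
Qed.

Lemma measurable_halfline f : (forall x : R, 0 < x -> {for x, continuous f}) ->
  measurable_fun H f.
Proof.
move=> cf; apply: open_continuous_measurable_fun; first exact: interval_open.
by move=> x; rewrite inE HP; exact: cf.
Qed.

Lemma is_derive_continuous f (x d : R) : is_derive x 1 f d -> {for x, continuous f}.
Proof.
by move=> [df _]; apply: differentiable_continuous; exact/derivable1_diffP.
Qed.

Lemma integrable_scale (c : R) f : 0 < c -> mu.-integrable H (EFin \o f) ->
  (forall x, 0 < x -> 0 <= f x) ->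
  mu.-integrable H (EFin \o (fun x => f (c * x))) /\
  \int[mu]_(x in H) f x = c * \int[mu]_(x in H) f (c * x).
Proof.
move=> c0 intf f0; have [mf _] := integrableP _ _ _ intf.
have scale := @ge0_integral_scale R c (EFin \o f) c0 mf f0.
have foo : (\int[mu]_(x in H) (EFin \o f) x)%E \is a fin_num.
  exact: integrable_fin_num.
have mfc : measurable_fun H (fun x => f (c * x)).
  apply: (@measurable_comp _ _ _ _ _ _ H); last exact: mulrl_measurable.
  - exact: mH.
  - by move=> _ [x + <-]; rewrite !HP; exact: mulr_gt0.
  - exact/measurable_EFinP.
split.
  apply: integrable_ge0_halfline => //; first by move=> x x0; rewrite f0// mulr_gt0.
  move: foo; rewrite scale ge0_fin_numE; last first.
    apply: mule_ge0; first by rewrite lee_fin ltW.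
    by apply: integral_ge0 => x; rewrite HP => x0; rewrite lee_fin f0// mulr_gt0.
  by apply: contraTT; rewrite -!leNgt !leye_eq => /eqP ->; rewrite gt0_muley ?lte_fin.
rewrite /Rintegral scale; case: (integral _ _ _) => [r| |]//=.
- by rewrite gt0_muley ?lte_fin//= mulr0.
- by rewrite gt0_muleNy ?lte_fin//= mulr0.
Qed.

Lemma Rintegral_eq0_ae f : mu.-integrable H (EFin \o f) ->
  (forall x, 0 < x -> 0 <= f x) -> \int[mu]_(x in H) f x = 0 ->
  ae_eq mu H (EFin \o f) (cst 0%E).
Proof.
move=> intf f0 if0; have [mf _] := integrableP _ _ _ intf.
apply/(ae_eq_integral_abs mu mH) => //.
rewrite (_ : integral _ _ _ = \int[mu]_(x in H) (f x)%:E)%E; last first.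
  by apply: eq_integral => x; rewrite inE HP => x0 /=; rewrite ger0_norm// f0.
by rewrite -[LHS]fineK ?integrable_fin_num// -[fine _]/(Rintegral _ _ _) if0.
Qed.

Lemma Rintegral_gt0 f : mu.-integrable H (EFin \o f) ->
  (forall x, 0 < x -> 0 < f x) -> 0 < \int[mu]_(x in H) f x.
Proof.
move=> intf f0; rewrite lt_neqAle Rintegral_ge0 ?andbT; last first.
  by move=> x; rewrite HP => /f0/ltW.
apply/eqP => /esym if0.
have [] := Rintegral_eq0_ae intf _ if0; first by move=> x /f0/ltW.
(* A zero integral would put the whole half-line, of infinite measure, inside a null set. *)
move=> N [mN N0 HN]; have : (mu H <= mu N)%E.
  apply: le_measure; rewrite ?inE// => x Hx; apply: HN => /= /(_ Hx) [].
  by apply/eqP; rewrite gt_eqF// f0// -HP.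
by rewrite N0 lebesgue_measure_itv/= ltry leye_eq.
Qed.

(** On [1/(n+2), n+2] the integral is F(b) - F(a) <= 2M. These intervals exhaust the half-line, so
    monotone convergence applies. *)
Lemma bounded_primitive_integrable F f (M : R) :
  (forall x : R, 0 < x -> is_derive x 1 F (f x)) ->
  (forall x : R, 0 < x -> {for x, continuous f}) ->
  (forall x, 0 < x -> 0 <= f x) ->
  (forall x, 0 < x -> `|F x| <= M) ->
  mu.-integrable H (EFin \o f).
Proof.
move=> dF cf f0 FM; have mf := measurable_halfline cf.
apply: integrable_ge0_halfline => //.
pose G n := `[(n.+2%:R)^-1, n.+2%:R]%classic : set R.
have GH n : G n `<=` H.
  by move=> x; rewrite /G HP/= in_itv/= => /andP[+ _]; apply: lt_le_trans; rewrite invr_gt0.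
have HG : H = \bigcup_n G n.
  apply/seteqP; split => [x|x [n _ /GH//]]; rewrite HP => x0.
  have [n nx] : exists n, x + x^-1 < n%:R.
    by exists (Num.truncn (x + x^-1)).+1; exact: truncnS_gt.
  have xV : 0 < x^-1 by rewrite invr_gt0.
  have n2 : (n%:R : R) < n.+2%:R by rewrite ltr_nat; lia.
  exists n => //; rewrite /G/= in_itv/= -[leRHS]invrK lef_pV2 ?posrE//; lra.
rewrite HG; apply: (@le_lt_trans _ _ (M + M)%:E); last by rewrite ltry.
have ndG : nondecreasing_seq G.
  move=> m n mn; rewrite subsetEset => x; rewrite /G/= !in_itv/= => /andP[a b].
  apply/andP; split.
    by apply: le_trans a; rewrite lef_pV2 ?posrE// ler_nat; lia.
  by apply: (le_trans b); rewrite ler_nat; lia.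
have mfG n : measurable_fun (G n) (EFin \o f).
  by apply: measurable_funS (@GH n) _ => //; exact/measurable_EFinP.
have f0G n x : G n x -> (0 <= (EFin \o f) x)%E by rewrite lee_fin => /GH; rewrite HP; exact: f0.
have cvgG : (\int[mu]_(x in G i) (f x)%:E @[i --> \oo] -->
    \int[mu]_(x in \bigcup_i G i) (f x)%:E)%E.
  by apply: ge0_nondecreasing_set_cvg_integral => //= i; exact: measurable_itv.
rewrite -(cvg_lim _ cvgG)//; apply: lime_le; first by apply/cvg_ex; eexists; exact: cvgG.
apply: nearW => n; pose a : R := (n.+2%:R)^-1; pose b : R := n.+2%:R.
have a0 : 0 < a by rewrite invr_gt0.
have ab : a < b by apply: (@lt_trans _ _ 1); rewrite ?invf_lt1 ?ltr1n.
rewrite (continuous_FTC2 (F := F) ab).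
- rewrite -EFinD lee_fin; have := FM a a0; have := FM b (lt_trans a0 ab).
  by rewrite !ler_norml; lra.
- apply: continuous_in_subspaceT => x; rewrite inE/= in_itv/= => /andP[ax _].
  by apply: cf; apply: lt_le_trans ax.
- split => [x| |].
  + by rewrite in_itv/= => /andP[ax _]; have [] := dF x (lt_trans a0 ax).
  + by apply: cvg_at_right_filter; exact: is_derive_continuous (dF a a0).
  + by apply: cvg_at_left_filter; exact: is_derive_continuous (dF b (lt_trans a0 ab)).
- move=> x; rewrite in_itv/= => /andP[ax _].
  by rewrite derive1E; have [] := dF x (lt_trans a0 ax).
Qed.


End HalfLineIntegrals.

Section RealIntegrable.
Context {R : realType} d {Y : measurableType d} {mu : {measure set Y -> \bar R}}.
Context (B : set Y) (mB : measurable B).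
Implicit Types f g : Y -> R.

Lemma eq_integrable_EFin f g : {in B, f =1 g} ->
  mu.-integrable B (EFin \o f) -> mu.-integrable B (EFin \o g).
Proof. by move=> fg; apply: eq_integrable => // t Bt /=; rewrite fg. Qed.

Lemma integrableZl_EFin (k : R) f : mu.-integrable B (EFin \o f) ->
  mu.-integrable B (EFin \o (fun t => k * f t)).
Proof. by move=> intf; apply: eq_integrable (integrableZl mB k intf). Qed.

Lemma integral_EFin f : mu.-integrable B (EFin \o f) ->
  (\int[mu]_(t in B) (f t)%:E)%E = (\int[mu]_(t in B) f t)%:E.
Proof. by move=> intf; rewrite -[LHS]fineK// integrable_fin_num. Qed.

Lemma integrable_sum_EFin n (h : 'I_n -> Y -> R) :
  (forall i, mu.-integrable B (EFin \o h i)) ->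
  mu.-integrable B (EFin \o (fun t => \sum_(i < n) h i t)).
Proof.
move=> inth; apply: eq_integrable (integrable_sum mB _ (fun i _ => inth i)) => //.
by move=> t _; rewrite /= -sumEFin.
Qed.

Lemma Rintegral_sum n (h : 'I_n -> Y -> R) :
  (forall i, mu.-integrable B (EFin \o h i)) ->
  \int[mu]_(t in B) (\sum_(i < n) h i t) = \sum_(i < n) \int[mu]_(t in B) h i t.
Proof.
elim: n h => [|n IH] h inth.
  under eq_Rintegral do rewrite big_ord0.
  by rewrite Rintegral_cst// mul0r big_ord0.
rewrite big_ord_recl -IH// -RintegralD//; last exact: integrable_sum_EFin.
by apply: eq_Rintegral => t _; rewrite big_ord_recl.
Qed.

End RealIntegrable.

(** * Differentiation of Laplace-type integrals *)

Section Laplace.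
Context {R : realType} d {Y : measurableType d} {mu : {measure set Y -> \bar R}}.
Context (B : set Y) (mB : measurable B) (f g : Y -> R).
Hypothesis mf : measurable_fun B f.
Hypothesis mg : measurable_fun B g.
Hypothesis f_ge0 : forall t, B t -> 0 <= f t.
Hypothesis g_ge0 : forall t, B t -> 0 <= g t.
Hypothesis intf : forall y : R, 0 < y ->
  mu.-integrable B (EFin \o (fun t => f t * expR (- (y * g t)))).

(** With s = (y/2) g, the bound s e^(-s) <= 1 gives g e^(-y g) <= (2/y) e^(-(y/2) g), and the
    hypothesis applies at y/2. *)
Lemma integrable_laplace_derive (y : R) : 0 < y ->
  mu.-integrable B (EFin \o (fun t => f t * g t * expR (- (y * g t)))).
Proof.
move=> y0; pose G t := (2 / y) * (f t * expR (- (y / 2 * g t))).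
have intG : mu.-integrable B (EFin \o G).
  by apply: integrableZl_EFin => //; apply: intf; rewrite divr_gt0.
apply: le_integrable intG => // [|t Bt].
  apply/measurable_EFinP; apply: measurable_funM; first exact: measurable_funM.
  apply: measurableT_comp => //; apply: measurableT_comp => //.
  exact: measurable_funM.
have y20 : 0 <= 2 / y by apply: divr_ge0 => //; exact: ltW.
rewrite /= lee_fin /G !ger0_norm ?mulr_ge0 ?expR_ge0 ?f_ge0 ?g_ge0 ?invr_ge0 ?(ltW y0)//.
have -> : - (y * g t) = - (y / 2 * g t) + - (y / 2 * g t) by field.
rewrite expRD; set s := y / 2 * g t.
have -> : g t = 2 / y * s by rewrite /s; field; rewrite gt_eqF.
have s1 : s * expR (- s) <= 1.
  rewrite expRN ler_pdivrMr ?expR_gt0// mul1r.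
  by apply: le_trans (expR_ge1Dx s); rewrite lerDr.
have -> : f t * (2 / y * s) * (expR (- s) * expR (- s)) =
  (2 / y) * (f t * expR (- s)) * (s * expR (- s)) by ring.
apply: ler_piMr => //; apply: mulr_ge0 => //; apply: mulr_ge0.
  exact: f_ge0.
exact: expR_ge0.
Qed.

(** Dominated differentiation on ]y/2, y+1[, with the derivative at y/2 as majorant. It is applied
    with g(t) = t for the recurrences of [Gamma] and [rho], and with g(t) = 1/t for the derivative
    of [rho]. *)
Lemma is_derive_laplace (y : R) : 0 < y ->
  is_derive y 1 (fun z => \int[mu]_(t in B) (f t * expR (- (z * g t))))
    (- \int[mu]_(t in B) (f t * g t * expR (- (y * g t)))).
Proof.
move=> y0; pose F (z : R) t := f t * expR (- (z * g t)).
have dF (z : R) t : is_derive z 1 (F ^~ t) (- (f t * g t * expR (- (z * g t)))).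
  rewrite /F; apply: is_derive_eq; rewrite /GRing.scale/=; ring.
have y2 : 0 < y / 2 by rewrite divr_gt0.
pose G t := `|f t * g t * expR (- (y / 2 * g t))|.
have Iy : `]y / 2, (y + 1)[%classic y by rewrite /= in_itv/=; lra.
have IP z : `]y / 2, (y + 1)[%classic z -> y / 2 < z by rewrite /= in_itv/= => /andP[].
have intFz z : `]y / 2, (y + 1)[%classic z -> mu.-integrable B (EFin \o F z).
  by move=> /IP yz; apply: intf; lra.
have derF z t : `]y / 2, (y + 1)[%classic z -> B t -> derivable (F ^~ t) z 1.
  by move=> _ _; have [] := dF z t.
have dE z t : partial1of2 F z t = - (f t * g t * expR (- (z * g t))).
  by rewrite partial1of2E; have [] := dF z t.
have intG : mu.-integrable B (EFin \o G).
  have := integrable_laplace_derive y2.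
  move=> /integrable_abse; apply: eq_integrable => // t _ /=.
have G_ub z t : `]y / 2, (y + 1)[%classic z -> B t -> `|partial1of2 F z t| <= G t.
  move=> /IP yz Bt; rewrite dE normrN /G !normrM ler_wpM2l ?mulr_ge0//.
  rewrite !ger0_norm ?expR_ge0// ler_expR lerN2 ler_wpM2r ?g_ge0//.
  exact: ltW.
apply: DeriveDef.
  exact: (derivable_under_integral mB Iy intFz derF (fun=> normr_ge0 _) intG G_ub).
rewrite -derive1E.
rewrite (differentiation_under_integral mB Iy intFz derF (fun=> normr_ge0 _) intG G_ub).
under eq_Rintegral do rewrite dE -mulN1r.
by rewrite RintegralZl ?mulN1r//; exact: integrable_laplace_derive.
Qed.

End Laplace.

(** * The functions Gamma and rho *)

Section GammaFunction.
Context {R : realType}.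
Local Notation mu := (@lebesgue_measure R).
Local Notation H := (`]0, +oo[%classic : set R).
Implicit Types (a b c x y t nu : R).

Let mH : measurable (H : set (measurableTypeR R)). Proof. exact: measurable_itv. Qed.
Hint Resolve mH : core.

Let HP x : H x = (0 < x) :> Prop.
Proof. by rewrite /= in_itv/= andbT. Qed.

Lemma measurable_powR_on (D : set R) a : measurable_fun D (fun t : R => t `^ a).
Proof. by apply: measurable_funTS; exact: measurable_powR. Qed.

Lemma powR_subr1M a t : 0 < t -> t `^ (a - 1) * t = t `^ a.
Proof.
by move=> t0; rewrite -{2}(powRr1 (ltW t0)) -powRD ?subrK// (gt_eqF t0) implybT.
Qed.

(** Exponents in ]0, 1] are treated by an explicit primitive and a rescaling; larger ones by unit
    steps, since differentiating a Laplace integral multiplies the integrand by t. *)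
Lemma integrable_gamma a c : 0 < a -> 0 < c ->
  mu.-integrable H (EFin \o (fun t => t `^ (a - 1) * expR (- (c * t)))).
Proof.
have small b : 0 < b <= 1 -> mu.-integrable H (EFin \o (fun t => t `^ (b - 1) * expR (- t))).
  move=> /andP[b0 b1].
  (* F is a bounded primitive of f, and t^b <= 1 + t gives t^(b-1) e^(-t) <= (e/b) f(t). *)
  pose F (t : R) := - expR (- t `^ b); pose f t := b * t `^ (b - 1) * expR (- t `^ b).
  have dF t : 0 < t -> is_derive t 1 F (f t).
    move=> t0; have dp := is_derive1_powR b t0.
    have dn : is_derive t 1 (fun t => - t `^ b) (- (b * t `^ (b - 1))) by exact: is_deriveN.
    have de := @is_derive1_comp _ expR (fun t => - t `^ b) t _ _ (is_derive_expR _) dn.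
    have : is_derive t 1 F (- (expR (- t `^ b) * - (b * t `^ (b - 1)))) by exact: is_deriveN.
    by move/is_derive_eq; apply; rewrite /f; ring.
  have cf t : 0 < t -> {for t, continuous f}.
    move=> t0; have cp (p : R) : {for t, continuous (fun s : R => s `^ p)}.
      exact: is_derive_continuous (is_derive1_powR p t0).
    apply: cvgM; first by apply: cvgM; [exact: cvg_cst|exact: cp].
    by apply: (cvg_comp _ _ (cvgN (cp b))); exact: continuous_expR.
  have intf : mu.-integrable H (EFin \o f).
    apply: (@bounded_primitive_integrable _ F f 1) => // t t0.
      by rewrite /f !mulr_ge0 ?powR_ge0 ?expR_ge0 ?(ltW b0).
    by rewrite /F normrN ger0_norm ?expR_ge0// -expR0 ler_expR oppr_le0 powR_ge0.
  have := integrableZl_EFin mH (expR 1 / b) intf; apply: le_integrable => //.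
    apply/measurable_EFinP; apply: measurable_funM; first exact: measurable_powR_on.
    exact: measurableT_comp.
  move=> t; rewrite HP => t0; rewrite /= lee_fin /f.
  rewrite !ger0_norm ?mulr_ge0 ?powR_ge0 ?expR_ge0 ?invr_ge0 ?(ltW b0)//.
  have -> : expR 1 / b * (b * t `^ (b - 1) * expR (- t `^ b)) =
    t `^ (b - 1) * expR (1 - t `^ b) by rewrite expRD; field; rewrite gt_eqF.
  rewrite ler_wpM2l ?powR_ge0// ler_expR.
  have [t1|t1] := leP t 1.
    by have := ge0_ler_powR (ltW b0) (ltW t0 : t \in Num.nneg) ler01 t1; rewrite powR1 => ?; lra.
  by have := ler1_powR (ltW t1) b1; lra.
have scaled b : (0 < b -> mu.-integrable H (EFin \o (fun t => t `^ (b - 1) * expR (- t)))) ->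
    0 < b -> forall y, 0 < y -> mu.-integrable H (EFin \o (fun t => t `^ (b - 1) * expR (- (y * t)))).
  move=> intb b0 y y0; have [|+ _] := integrable_scale y0 (intb b0).
    by move=> t t0; rewrite mulr_ge0 ?powR_ge0 ?expR_ge0.
  move=> /(integrableZl_EFin mH (y `^ (b - 1))^-1); apply: eq_integrable_EFin => // t.
  rewrite inE HP => t0; rewrite powRM ?ltW//.
  by field; rewrite gt_eqF// powR_gt0.
have main n b : 0 < b <= n.+1%:R -> forall y, 0 < y ->
    mu.-integrable H (EFin \o (fun t => t `^ (b - 1) * expR (- (y * t)))).
  elim: n b => [|n IH] b /andP[b0 bn].
    by apply: scaled => // _; apply: small; rewrite b0.
  have [b1|b1] := leP b n.+1%:R; first by apply: IH; rewrite b0.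
  have b10 : 0 < b - 1 by move: b1; rewrite -natr1; have := ler0n R n; lra.
  have IHb := IH (b - 1) _; move=> y y0.
  have intb : mu.-integrable H (EFin \o
      (fun t => t `^ (b - 1 - 1) * t * expR (- (y * t)))).
    apply: (@integrable_laplace_derive _ _ _ mu H mH (fun t => t `^ (b - 1 - 1)) idfun) => //.
    - exact: measurable_powR_on.
    - exact: measurable_id.
    - by move=> t Ht; rewrite powR_ge0.
    - by move=> t; rewrite HP => /ltW.
    - by apply: IHb; rewrite b10/=; move: bn; rewrite -natr1; lra.
  by apply: eq_integrable_EFin intb => // t; rewrite inE HP => t0; rewrite powR_subr1M.
move=> a0 c0; apply: (main (Num.truncn a)) => //.
by rewrite a0 ltW// truncnS_gt.
Qed.

Lemma integrable_gammaE a : 0 < a ->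
  mu.-integrable H (EFin \o (fun t => t `^ (a - 1) * expR (- t))).
Proof.
move=> a0; apply: eq_integrable_EFin (integrable_gamma a0 ltr01) => // t _.
by rewrite mul1r.
Qed.

Lemma Gamma_gt0 a : 0 < a -> 0 < Gamma a.
Proof.
move=> a0; apply: Rintegral_gt0; first exact: integrable_gammaE.
by move=> t t0; rewrite mulr_gt0 ?powR_gt0 ?expR_gt0.
Qed.

Lemma Gamma_scale a y : 0 < a -> 0 < y ->
  \int[mu]_(t in H) (t `^ (a - 1) * expR (- (y * t))) = y `^ (- a) * Gamma a.
Proof.
move=> a0 y0; have [|_] := integrable_scale y0 (integrable_gammaE a0).
  by move=> t t0; rewrite mulr_ge0 ?powR_ge0 ?expR_ge0.
move=> /= e; rewrite /Gamma e.
rewrite -RintegralZl//; last first.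
  have := integrableZl_EFin mH (y `^ (a - 1)) (integrable_gamma a0 y0).
  apply: eq_integrable_EFin => // t; rewrite inE HP => t0.
  by rewrite powRM ?ltW// mulrA.
rewrite -RintegralZl//; last first.
  have := integrableZl_EFin mH (y * y `^ (a - 1)) (integrable_gamma a0 y0).
  apply: eq_integrable_EFin => // t; rewrite inE HP => t0.
  by rewrite powRM ?ltW// !mulrA.
apply: eq_Rintegral => t; rewrite inE HP => t0.
rewrite powRM ?ltW// powRN -(powR_subr1M a y0); field.
by rewrite !gt_eqF ?powR_gt0.
Qed.

(** Both sides of [Gamma_scale] are differentiated at y = 1. *)
Lemma Gamma_rec a : 0 < a -> Gamma (a + 1) = a * Gamma a.
Proof.
move=> a0; have d1 : is_derive (1 : R) 1 (fun z => \int[mu]_(t in H) (t `^ (a - 1) * expR (- (z * t))))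
    (- Gamma (a + 1)).
  have -> : Gamma (a + 1) = \int[mu]_(t in H) (t `^ (a - 1) * t * expR (- (1 * t))).
    apply: eq_Rintegral => t; rewrite inE HP => t0.
    by rewrite mul1r powR_subr1M// addrK.
  apply: (@is_derive_laplace _ _ _ mu H mH (fun t => t `^ (a - 1)) idfun) => //.
  - exact: measurable_powR_on.
  - exact: measurable_id.
  - by move=> t Ht; rewrite powR_ge0.
  - by move=> t; rewrite HP => /ltW.
  - by move=> y y0; exact: integrable_gamma.
have d2 : is_derive (1 : R) 1 (fun z => z `^ (- a) * Gamma a) (- a * Gamma a).
  have dp := is_derive1_powR (- a) (@ltr01 R).
  have dm := is_deriveM dp (is_derive_cst (Gamma a) (1 : R) 1).
  apply: (is_derive_eq dm).
  by rewrite /GRing.scale/= powR1 /cst; ring.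
have d3 : is_derive (1 : R) 1 (fun z => \int[mu]_(t in H) (t `^ (a - 1) * expR (- (z * t))))
    (- a * Gamma a).
  apply: near_eq_is_derive d2; near=> z; rewrite Gamma_scale//.
  by near: z; exact: lt_nbhsr.
have [_ e1] := d1; have [_ e3] := d3.
by apply: oppr_inj; rewrite -mulNr; exact: etrans (esym e1) e3.
Unshelve. all: by end_near. Qed.

Lemma GammaS n : Gamma (n.+1%:R : R) = n`!%:R.
Proof.
elim: n => [|n IH]; last by rewrite -natr1 Gamma_rec ?IH// factS natrM.
rewrite fact0.
have dF (t : R) : is_derive t 1 (fun t => - expR (- t)) (expR (- t)).
  have de := @is_derive1_comp _ expR -%R t _ _ (is_derive_expR _) (is_deriveNid t (1 : R)).
  have : is_derive t 1 (fun t => - expR (- t)) (- (expR (- t) * - 1)) by exact: is_deriveN.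
  by move/is_derive_eq; apply; ring.
transitivity (\int[mu]_(t in H) expR (- t)).
  by apply: eq_Rintegral => t _; rewrite subrr powRr0 mul1r.
have cexp : continuous (fun t : R => expR (- t)).
  by move=> t; apply: (cvg_comp _ _ (cvgN cvg_id)); exact: continuous_expR.
rewrite Rintegral_itv_obnd_cbnd; last first.
  apply: eq_integrable_EFin (integrable_gammaE ltr01) => // t _.
  by rewrite subrr powRr0 mul1r.
rewrite (@Rintegral_ge0_continuous_FTC2y _ _ (fun t => - expR (- t)) 0 0).
- by rewrite oppr0 expR0; ring.
- by move=> t _; rewrite expR_ge0.
- exact: continuous_subspaceT.
- rewrite -oppr0; apply: cvgN.
  have := @cvgr_expR R; exact.
- by move=> t _; have [] := dF t.
- by apply: cvg_at_right_filter; exact: is_derive_continuous (dF 0).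
- by move=> t _; rewrite derive1E; have [] := dF t.
Qed.

End GammaFunction.

Section Rho.
Context {R : realType}.
Local Notation mu := (@lebesgue_measure R).
Local Notation H := (`]0, +oo[%classic : set R).
Implicit Types (a b c x y t nu : R).

Let mH : measurable (H : set (measurableTypeR R)). Proof. exact: measurable_itv. Qed.
Hint Resolve mH : core.

Let HP x : H x = (0 < x) :> Prop.
Proof. by rewrite /= in_itv/= andbT. Qed.

Let measurable_invH : measurable_fun H (fun t : R => t^-1).
Proof.
apply: (eq_measurable_fun (fun t : R => t `^ (-1))); last exact: measurable_powR_on.
by move=> t; rewrite inE HP => t0; rewrite powR_inv1// ltW.
Qed.

(** For N = n + 1 > - nu, the bound e^(-x/t) <= N! (t/x)^N raises the exponent of t enough for
    [integrable_gamma]. *)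
Lemma integrable_rho nu c x : 0 < c -> 0 < x ->
  mu.-integrable H (EFin \o (fun t => t `^ (nu - 1) * expR (- (c * t) - x / t))).
Proof.
move=> c0 x0; pose n := Num.truncn `|nu|.
have n0 : 0 < nu + n.+1%:R.
  have := truncnS_gt `|nu|; rewrite -/n; have := ler_norm (- nu).
  by rewrite normrN; lra.
have := integrableZl_EFin mH (n.+1`!%:R / x ^+ n.+1) (integrable_gamma n0 c0).
apply: le_integrable => //.
  apply/measurable_EFinP; apply: measurable_funM; first exact: measurable_powR_on.
  apply: measurableT_comp => //; apply: measurable_funB.
    exact: measurableT_comp.
  exact: measurable_funM.
move=> t; rewrite HP => t0; rewrite /= lee_fin.
have f0 : 0 < (n.+1`!%:R : R) by rewrite ltr0n fact_gt0.
have xn0 : 0 < x ^+ n.+1 by rewrite exprn_gt0.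
rewrite !ger0_norm ?mulr_ge0 ?powR_ge0 ?expR_ge0 ?invr_ge0 ?(ltW f0) ?(ltW xn0)//.
have -> : t `^ (nu + n.+1%:R - 1) = t `^ (nu - 1) * t ^+ n.+1.
  rewrite -powR_mulrn ?ltW// -powRD; last by rewrite (gt_eqF t0) implybT.
  by congr (_ `^ _); ring.
rewrite expRD expRN.
have -> : n.+1`!%:R / x ^+ n.+1 * (t `^ (nu - 1) * t ^+ n.+1 * (expR (c * t))^-1) =
  t `^ (nu - 1) * ((expR (c * t))^-1 * (n.+1`!%:R / (x / t) ^+ n.+1)).
  by rewrite expr_div_n; field; rewrite !gt_eqF ?exprn_gt0 ?expR_gt0.
rewrite ler_wpM2l ?powR_ge0// ler_wpM2l ?invr_ge0 ?expR_ge0//.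
have xt0 : 0 < (x / t) ^+ n.+1 by rewrite exprn_gt0 ?divr_gt0.
rewrite expRN -[leRHS]invf_div lef_pV2 ?posrE ?expR_gt0 ?divr_gt0//.
by have := expR_ge1Dxn n (ltW (divr_gt0 x0 t0)); lra.
Qed.

Lemma integrable_rhoE nu x : 0 < x ->
  mu.-integrable H (EFin \o (fun t => t `^ (nu - 1) * expR (- t - x / t))).
Proof.
move=> x0; apply: eq_integrable_EFin (integrable_rho nu ltr01 x0) => // t _.
by rewrite mul1r.
Qed.

Lemma rho_gt0 nu x : 0 < x -> 0 < rho nu x.
Proof.
move=> x0; apply: Rintegral_gt0; first exact: integrable_rhoE.
by move=> t t0; rewrite mulr_gt0 ?powR_gt0 ?expR_gt0.
Qed.

Lemma is_derive_rho nu x : 0 < x -> is_derive x 1 (rho nu) (- rho (nu - 1) x).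
Proof.
move=> x0.
have -> : rho nu = fun z => \int[mu]_(t in H) (t `^ (nu - 1) * expR (- t) * expR (- (z * t^-1))).
  by apply/funext => z; apply: eq_Rintegral => t _; rewrite -mulrA -expRD.
have -> : rho (nu - 1) x = \int[mu]_(t in H)
    (t `^ (nu - 1) * expR (- t) * t^-1 * expR (- (x * t^-1))).
  apply: eq_Rintegral => t; rewrite inE HP => t0.
  rewrite -(powR_subr1M (nu - 1) t0) expRD; field; rewrite gt_eqF//.
apply: (@is_derive_laplace _ _ _ mu H mH (fun t => t `^ (nu - 1) * expR (- t)) GRing.inv) => //.
- apply: measurable_funM; first exact: measurable_powR_on.
  exact: measurableT_comp.
- by move=> t Ht; rewrite mulr_ge0 ?powR_ge0 ?expR_ge0.
- by move=> t; rewrite HP invr_ge0 => /ltW.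
- move=> y y0; apply: eq_integrable_EFin (integrable_rhoE nu y0) => // t _.
  by rewrite -mulrA -expRD.
Qed.

Lemma continuous_rho nu x : 0 < x -> {for x, continuous (rho nu)}.
Proof. by move=> x0; exact: is_derive_continuous (is_derive_rho nu x0). Qed.

Lemma rho_scale nu c x : 0 < c -> 0 < x ->
  \int[mu]_(t in H) (t `^ (nu - 1) * expR (- (c * t) - x / t)) =
  c `^ (- nu) * rho nu (c * x).
Proof.
move=> c0 x0; have cx0 : 0 < c * x by exact: mulr_gt0.
have [|_] := integrable_scale c0 (integrable_rhoE nu cx0).
  by move=> t t0; rewrite mulr_ge0 ?powR_ge0 ?expR_ge0.
move=> /= eI; rewrite /rho eI.
have e t : 0 < t -> (c * t) `^ (nu - 1) * expR (- (c * t) - c * x / (c * t)) =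
    c `^ (nu - 1) * (t `^ (nu - 1) * expR (- (c * t) - x / t)).
  move=> t0; rewrite powRM ?ltW// mulrA; congr (_ * expR (_ - _)).
  by field; rewrite !gt_eqF.
have -> : \int[mu]_(t in H) ((c * t) `^ (nu - 1) * expR (- (c * t) - c * x / (c * t))) =
    c `^ (nu - 1) * \int[mu]_(t in H) (t `^ (nu - 1) * expR (- (c * t) - x / t)).
  rewrite -RintegralZl//; last exact: integrable_rho.
  by apply: eq_Rintegral => t; rewrite inE HP => /e.
rewrite powRN -(powR_subr1M nu c0); field.
by rewrite !gt_eqF ?powR_gt0.
Qed.

(** Both sides of [rho_scale] are differentiated in c at c = 1: the integral gives - rho_{nu+1}(x),
    the product - nu rho_nu(x) - x rho_{nu-1}(x). *)
Lemma rho_rec nu x : 0 < x ->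
  rho (nu + 1) x = nu * rho nu x + x * rho (nu - 1) x.
Proof.
move=> x0; pose L c := \int[mu]_(t in H) (t `^ (nu - 1) * expR (- x / t) * expR (- (c * t))).
have LE c : 0 < c -> L c = c `^ (- nu) * rho nu (c * x).
  move=> c0; rewrite -(rho_scale nu c0 x0); apply: eq_Rintegral => t _.
  by rewrite -mulrA -expRD/=; congr (_ * expR _); ring.
have d1 : is_derive (1 : R) 1 L (- rho (nu + 1) x).
  have -> : rho (nu + 1) x = \int[mu]_(t in H) (t `^ (nu - 1) * expR (- x / t) * t * expR (- (1 * t))).
    apply: eq_Rintegral => t; rewrite inE HP => t0.
    by rewrite mul1r addrK -(powR_subr1M nu t0) expRD mulNr; ring.
  apply: (@is_derive_laplace _ _ _ mu H mH (fun t => t `^ (nu - 1) * expR (- x / t)) idfun) => //.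
  - apply: measurable_funM; first exact: measurable_powR_on.
    apply: measurableT_comp => //.
    exact: measurable_funM.
  - exact: measurable_id.
  - by move=> t Ht; rewrite mulr_ge0 ?powR_ge0 ?expR_ge0.
  - by move=> t; rewrite HP => /ltW.
  - move=> y y0; apply: eq_integrable_EFin (integrable_rho nu y0 x0) => // t _.
    by rewrite -mulrA -expRD/=; congr (_ * expR _); ring.
have d2 : is_derive (1 : R) 1 (fun c => c `^ (- nu) * rho nu (c * x))
    (- nu * rho nu x - x * rho (nu - 1) x).
  have dp := is_derive1_powR (- nu) (@ltr01 R).
  have dx : is_derive (1 : R) 1 (fun c => c * x) x.
    apply: (is_derive_eq (is_deriveM (is_derive_id (1 : R) 1) (is_derive_cst x (1 : R) 1))).
    by rewrite /GRing.scale/= /cst; ring.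
  have x10 : 0 < 1 * x by rewrite mul1r.
  have dr := @is_derive1_comp _ (rho nu) (fun c => c * x) 1 _ _ (is_derive_rho nu x10) dx.
  apply: (is_derive_eq (is_deriveM dp dr)).
  rewrite /GRing.scale/= powR1 mul1r; move: (rho nu x) (rho (nu - 1) x) => A B.
  by ring.
have d3 : is_derive (1 : R) 1 L (- nu * rho nu x - x * rho (nu - 1) x).
  apply: near_eq_is_derive d2; near=> z; rewrite LE//.
  by near: z; exact: lt_nbhsr.
have [_ e1] := d1; have [_ e3] := d3.
by apply: oppr_inj; rewrite opprD -mulNr; exact: etrans (esym e1) e3.
Unshelve. all: by end_near. Qed.

End Rho.

(** * Moments of the weight *)

Section Moments.
Context {R : realType}.
Local Notation mu := (@lebesgue_measure R).
Local Notation H := (`]0, +oo[%classic : set R).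
Implicit Types (x t s nu : R) (m : nat).

Let mH : measurable (H : set (measurableTypeR R)). Proof. exact: measurable_itv. Qed.
Hint Resolve mH : core.

Let HP x : H x = (0 < x) :> Prop.
Proof. by rewrite /= in_itv/= andbT. Qed.

Lemma tonelli_halfline (f : R -> R -> R) :
  measurable_fun [set: measurableTypeR R * measurableTypeR R] (fun z => f z.1 z.2) ->
  (forall x t, 0 < x -> 0 < t -> 0 <= f x t) ->
  (\int[mu]_(x in H) \int[mu]_(t in H) (f x t)%:E =
   \int[mu]_(t in H) \int[mu]_(x in H) (f x t)%:E)%E.
Proof.
move=> mf f0.
pose F (z : measurableTypeR R * measurableTypeR R) : \bar R :=
  ((fun z => (f z.1 z.2)%:E) \_ (H `*` H)) z.
have mF : measurable_fun setT F.
  apply/(measurable_restrictT _ _).1; first exact: measurableX.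
  by apply: measurable_funTS; exact/measurable_EFinP.
have F0 z : (0 <= F z)%E.
  rewrite /F patchE; case: ifPn => //; rewrite inE => -[]; rewrite !HP => z1 z2.
  by rewrite lee_fin f0.
have E (x t : R) : F (x, t) = if (x \in H) && (t \in H) then (f x t)%:E else 0%E.
  by rewrite /F patchE in_setX.
have e := @fubini_tonelli _ _ (measurableTypeR R) (measurableTypeR R) R mu mu F mF F0.
transitivity (\int[mu]_x \int[mu]_t F (x, t))%E.
  rewrite integral_mkcond; apply: eq_integral => x _; rewrite patchE.
  case: ifPn => xH; last first.
    by apply/esym/integral0_eq => t _; rewrite E (negbTE xH).
  by rewrite integral_mkcond; apply: eq_integral => t _; rewrite patchE E xH.
rewrite e [RHS]integral_mkcond; apply: eq_integral => t _; rewrite patchE.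
case: ifPn => tH; last first.
  by apply/integral0_eq => x _; rewrite E (negbTE tH) andbF.
by rewrite [RHS]integral_mkcond; apply: eq_integral => x _; rewrite patchE E tH andbT.
Qed.

Let w nu m x := x ^+ m * (expR (- x) * rho nu x).
(** The integrand of Psi(1+m, 1-nu; 1). *)
Let v nu m s := expR (- s) * s ^+ m * (1 + s) `^ (- (1 + nu + m%:R)).

Let w_ge0 nu m x : 0 < x -> 0 <= w nu m x.
Proof.
by move=> x0; rewrite /w mulr_ge0 ?exprn_ge0 ?mulr_ge0 ?expR_ge0 ?(ltW x0) ?(ltW (rho_gt0 _ x0)).
Qed.

Let v_ge0 nu m s : 0 < s -> 0 <= v nu m s.
Proof.
by move=> s0; rewrite /v !mulr_ge0 ?exprn_ge0 ?expR_ge0 ?powR_ge0 ?(ltW s0).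
Qed.

(** The inverse of t is written as a real power so that joint measurability holds on the whole
    plane. *)
Let K nu m x t := x ^+ m * expR (- x) * (t `^ (nu - 1) * expR (- t - x * t `^ (- 1))).

Let KE nu m x t : 0 < t ->
  K nu m x t = x ^+ m * expR (- x) * (t `^ (nu - 1) * expR (- t - x / t)).
Proof. by move=> t0; rewrite /K powR_inv1// ltW. Qed.

(** [K] after the substitution x = t s, with the Jacobian t included. *)
Let G nu m t s := s ^+ m * expR (- s) *
  (t `^ (1 + nu + m%:R - 1) * expR (- ((1 + s) * t))).

Let measurable_powR_snd a : measurable_fun [set: measurableTypeR R * measurableTypeR R]
  (fun z => z.2 `^ a).
Proof. exact: (measurableT_comp (measurable_powR _) measurable_snd). Qed.

Let measurable_powR_fst a : measurable_fun [set: measurableTypeR R * measurableTypeR R]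
  (fun z => z.1 `^ a).
Proof. exact: (measurableT_comp (measurable_powR _) measurable_fst). Qed.

Let measurable_K nu m : measurable_fun [set: measurableTypeR R * measurableTypeR R]
  (fun z => K nu m z.1 z.2).
Proof.
apply: measurable_funM.
  apply: measurable_funM; first by apply: measurable_funX; exact: measurable_fst.
  by apply: measurableT_comp => //; apply: measurable_funN; exact: measurable_fst.
apply: measurable_funM; first exact: measurable_powR_snd.
apply: measurableT_comp => //; apply: measurable_funB.
  by apply: measurable_funN; exact: measurable_snd.
by apply: measurable_funM; [exact: measurable_fst|exact: measurable_powR_snd].
Qed.

Let measurable_G nu m : measurable_fun [set: measurableTypeR R * measurableTypeR R]
  (fun z => G nu m z.1 z.2).
Proof.
apply: measurable_funM.
  apply: measurable_funM; first by apply: measurable_funX; exact: measurable_snd.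
  by apply: measurableT_comp => //; apply: measurable_funN; exact: measurable_snd.
apply: measurable_funM; first exact: measurable_powR_fst.
apply: measurableT_comp => //; apply: measurable_funN; apply: measurable_funM.
  by apply: measurable_funD => //; exact: measurable_snd.
exact: measurable_fst.
Qed.

Let K_ge0 nu m x t : 0 < x -> 0 < t -> 0 <= K nu m x t.
Proof.
by move=> x0 t0; rewrite /K !mulr_ge0 ?exprn_ge0 ?expR_ge0 ?powR_ge0 ?(ltW x0).
Qed.

Let G_ge0 nu m t s : 0 < t -> 0 < s -> 0 <= G nu m t s.
Proof.
by move=> t0 s0; rewrite /G !mulr_ge0 ?exprn_ge0 ?expR_ge0 ?powR_ge0 ?(ltW s0).
Qed.

(** Tonelli, then x = t s, then Tonelli again; the inner integral over t is a Gamma integral at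
    scale 1 + s. The equality is between extended reals, so finiteness of the moments follows from
    that of the right side. *)
Let int_w nu m : -1 < nu ->
  (\int[mu]_(x in H) (w nu m x)%:E =
   \int[mu]_(s in H) (Gamma (1 + nu + m%:R) * v nu m s)%:E)%E.
Proof.
move=> nu1; have A0 : 0 < 1 + nu + m%:R by have := ler0n R m; lra.
transitivity (\int[mu]_(x in H) \int[mu]_(t in H) (K nu m x t)%:E)%E.
  apply: eq_integral => x; rewrite inE HP => x0.
  have intK : mu.-integrable H (EFin \o K nu m x).
    apply: eq_integrable_EFin (integrableZl_EFin mH (x ^+ m * expR (- x)) (integrable_rhoE nu x0)) => //.
    by move=> t; rewrite inE HP => t0; rewrite KE.
  rewrite (integral_EFin mH intK); congr EFin; rewrite /w mulrA.
  rewrite -(RintegralZl _ mH (integrable_rhoE nu x0)).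
  by apply: eq_Rintegral => t; rewrite inE HP => t0; rewrite KE.
rewrite tonelli_halfline//; last exact: K_ge0.
transitivity (\int[mu]_(t in H) \int[mu]_(s in H) (G nu m t s)%:E)%E.
  apply: eq_integral => t; rewrite inE HP => t0.
  have mK : measurable_fun H (fun x => K nu m x t).
    by apply: measurable_funTS; exact: (measurableT_comp (measurable_K nu m) (pair2_measurable t)).
  rewrite (ge0_integral_scale (f := fun x => (K nu m x t)%:E) t0); last 2 first.
  - exact/measurable_EFinP.
  - by move=> x x0; rewrite lee_fin K_ge0.
  rewrite -ge0_integralZl//=.
  - apply: eq_integral => s; rewrite inE HP => s0; rewrite -EFinM; congr EFin.
    rewrite KE// /G.
    have -> : t `^ (1 + nu + m%:R - 1) = t * t `^ (nu - 1) * t ^+ m.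
      rewrite [t * _]mulrC (powR_subr1M nu t0) -(powR_mulrn m (ltW t0)) -powRD.
        by congr (_ `^ _); ring.
      by rewrite (gt_eqF t0) implybT.
    have -> : expR (- ((1 + s) * t)) = expR (- (t * s)) * expR (- t).
      by rewrite -expRD; congr expR; ring.
    have -> : expR (- t - t * s / t) = expR (- t) * expR (- s).
      by rewrite -expRD; congr expR; field; rewrite gt_eqF.
    by rewrite exprMn; ring.
  - apply/measurable_EFinP; apply: (@measurable_comp _ _ _ _ _ _ H) mK _ => //.
    by move=> _ [x + <-]; rewrite !HP; exact: mulr_gt0.
  - by move=> s; rewrite in_itv/= andbT => s0; rewrite lee_fin K_ge0// mulr_gt0.
  - by rewrite lee_fin ltW.
rewrite tonelli_halfline//; last exact: G_ge0.
apply: eq_integral => s; rewrite inE HP => s0.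
have s10 : 0 < 1 + s by lra.
have intG : mu.-integrable H (EFin \o (G nu m)^~ s).
  exact: (integrableZl_EFin mH (s ^+ m * expR (- s)) (integrable_gamma A0 s10)).
rewrite (integral_EFin mH intG); congr EFin.
rewrite (RintegralZl _ mH (integrable_gamma A0 s10)).
by rewrite Gamma_scale// /v; ring.
Qed.

(** Since 1 + nu + m > 0, the power of 1 + s is at most 1 and s^m e^(-s) is a majorant. *)
Let integrable_v nu m : -1 < nu -> mu.-integrable H (EFin \o v nu m).
Proof.
move=> nu1; have := @integrable_gammaE R m.+1%:R; rewrite ltr0Sn => /(_ isT).
apply: le_integrable => //.
  apply/measurable_EFinP; apply: measurable_funM.
    apply: measurable_funM; last exact: exprn_measurable.
    by apply: measurableT_comp.
  apply: (measurableT_comp (f := fun t => t `^ _)); first exact: measurable_powR.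
  exact: measurable_funD.
move=> s; rewrite HP => s0; rewrite /= lee_fin.
have -> : (m.+1%:R - 1 : R) = m%:R by rewrite -natr1 addrK.
rewrite !ger0_norm ?v_ge0 ?mulr_ge0 ?powR_ge0 ?expR_ge0//.
rewrite (powR_mulrn m (ltW s0)) /v [X in _ <= X]mulrC.
rewrite ler_piMr ?mulr_ge0 ?exprn_ge0 ?expR_ge0 ?(ltW s0)//.
rewrite powRN invf_le1 ?powR_gt0; try lra.
rewrite -[leLHS](powRr0 (1 + s)) ler_powR//; first lra.
by have := ler0n R m; lra.
Qed.

Lemma integrable_moment nu m : -1 < nu ->
  mu.-integrable H (EFin \o (fun x => x ^+ m * (expR (- x) * rho nu x))).
Proof.
move=> nu1; apply: integrable_ge0_halfline; last 2 first.
- exact: w_ge0.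
- rewrite int_w//.
  have := integrableZl_EFin mH (Gamma (1 + nu + m%:R)) (integrable_v m nu1).
  by move=> /integrable_lty; exact.
apply: measurable_funM; first exact: exprn_measurable.
apply: measurable_funM; first exact: measurableT_comp.
by apply: measurable_halfline => x x0; exact: continuous_rho.
Qed.

Lemma moment_tricomi nu m : -1 < nu ->
  Gamma (1 + nu + m%:R) * tricomi (1 + m%:R) (1 - nu) 1 =
  (m`!%:R)^-1 * \int[mu]_(x in H) (x ^+ m * (expR (- x) * rho nu x)).
Proof.
move=> nu1; rewrite /tricomi nat1r GammaS mulrCA; congr (_ * _).
rewrite /Rintegral -[X in _ = fine X]/(\int[mu]_(x in H) (w nu m x)%:E)%E int_w//.
have intv := integrable_v m nu1.
rewrite (integral_EFin mH (integrableZl_EFin mH (Gamma (1 + nu + m%:R)) intv)).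
rewrite [RHS](RintegralZl _ mH intv).
congr (_ * _); apply: eq_Rintegral => s; rewrite inE HP => s0.
rewrite mul1r /v -(powR_mulrn _ (ltW s0)) -natr1 addrK; congr (_ * _ `^ _).
by ring.
Qed.

End Moments.

Definition moment (R : realType) (nu : R) (m : nat) : R :=
  \int[@lebesgue_measure R]_(x in `]0, +oo[) (x ^+ m * (expR (- x) * rho nu x)).

(** * The coefficients d_{k,m} as moments *)

Section DCoef.
Context {R : realType}.
Local Notation mu := (@lebesgue_measure R).
Local Notation H := (`]0, +oo[%classic : set R).
Implicit Types (nu x : R) (k m : nat).

Lemma rho_expansion nu x k : -1 < nu -> 0 < x ->
  \sum_(r < k.+1) (-1) ^+ (k + r) * 'C(k, r)%:R *
    (pochhammer (1 + nu) k / pochhammer (1 + nu) r) * rho (nu + (k + r)%:R) x =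
  x ^+ k * rho nu x.
Proof.
move=> nu1 x0.
suff fE j : x * rho (nu + j%:R) x =
    rho (nu + j.+2%:R) x - (nu + j.+1%:R) * rho (nu + j.+1%:R) x.
  by rewrite (@three_term_expansion _ nu x (fun j => rho (nu + j%:R) x) k nu1 fE) addr0.
have := rho_rec (nu + j.+1%:R) x0.
have -> : nu + j.+1%:R + 1 = nu + j.+2%:R by rewrite -[j.+2]addn1 natrD addrA.
have -> : nu + j.+1%:R - 1 = nu + j%:R by rewrite -addn1 natrD; ring.
by move=> ->; rewrite addrAC subrr add0r.
Qed.

(** By [moment_tricomi] each summand is, up to 1/m!, a moment of order m of e^(-x) rho_{nu+k+r};
    [rho_expansion] adds these functions up to x^k rho_nu. *)
Lemma dcoef_moment nu k m : -1 < nu ->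
  dcoef nu k m = Gamma (1 + nu) / m`!%:R * moment nu (m + k).
Proof.
move=> nu1; have mH : measurable (H : set (measurableTypeR R)) by exact: measurable_itv.
rewrite /dcoef -mulrA; congr (_ * _); rewrite /moment.
pose c (r : 'I_k.+1) := (-1) ^+ (k + r) * 'C(k, r)%:R *
    (pochhammer (1 + nu) k / pochhammer (1 + nu) r).
have nuk r : -1 < nu + (k + r)%:R by have := ler0n R (k + r); lra.
have intr (r : 'I_k.+1) : mu.-integrable H (EFin \o
    (fun x => c r * (x ^+ m * (expR (- x) * rho (nu + (k + r)%:R) x)))).
  by apply: integrableZl_EFin => //; exact: integrable_moment.
transitivity ((m`!%:R)^-1 * \int[mu]_(x in H) (\sum_(r < k.+1)
    c r * (x ^+ m * (expR (- x) * rho (nu + (k + r)%:R) x)))).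
  rewrite Rintegral_sum// mulr_sumr; apply: eq_bigr => r _.
  rewrite RintegralZl//; last exact: integrable_moment.
  rewrite [RHS]mulrCA -(moment_tricomi m (nuk r)).
  have -> : 1 + (nu + (k + r)%:R) + m%:R = 1 + nu + (k + r + m)%:R by rewrite !natrD; ring.
  have -> : 1 - (nu + (k + r)%:R) = 1 - nu - k%:R - r%:R by rewrite natrD; ring.
  by rewrite -mulrA.
congr (_ * _); apply: eq_Rintegral => x; rewrite inE/= in_itv/= andbT => x0.
transitivity (x ^+ m * expR (- x) * \sum_(r < k.+1) (c r * rho (nu + (k + r)%:R) x)).
  by rewrite mulr_sumr; apply: eq_bigr => r _; ring.
by rewrite rho_expansion// exprD; ring.
Qed.

End DCoef.

(** * Iterated derivatives and Riemann-Liouville integrals *)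

(* A family [F] with [F i.+1] the derivative of [F i] on the open half-line:
   it carries an identity between iterated derivatives to a pointwise identity
   between the members of the families. *)
Definition deriv_chain (R : realType) (F : nat -> R -> R) : Prop :=
  forall i (x : R), 0 < x -> is_derive x 1 (F i) (F i.+1 x).

Section DerivChain.
Context {R : realType}.
Implicit Types (F : nat -> R -> R) (f : R -> R) (x : R) (i j k n : nat).

Lemma deriv_chain_uniq F f d n x : deriv_chain F -> (forall x, 0 < x -> f x = F n x) ->
  0 < x -> is_derive x 1 f d -> d = F n.+1 x.
Proof.
move=> cF fF x0 df; have [_ <-] := cF n x x0; have [_ <-] := df.
apply: near_eq_derive; near=> z; apply: fF.
by near: z; exact: lt_nbhsr.
Unshelve. all: by end_near. Qed.

Lemma is_derive_halfline_eq f (g : R -> R) d x : (forall x, 0 < x -> f x = g x) ->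
  0 < x -> is_derive x 1 g d -> is_derive x 1 f d.
Proof.
move=> fg x0; apply: near_eq_is_derive; near=> z; rewrite fg//.
by near: z; exact: lt_nbhsr.
Unshelve. all: by end_near. Qed.

Lemma is_derive_cstM (c : R) f d x : is_derive x 1 f d ->
  is_derive x 1 (fun z => c * f z) (c * d).
Proof. by move=> df; exact: is_deriveZ. Qed.

Lemma derive1n_chain F f n x : deriv_chain F -> (forall x, 0 < x -> f x = F 0 x) ->
  0 < x -> derive1n n f x = F n x.
Proof.
move=> cF fF; elim: n x => [|n IH] x x0; first by rewrite derive1n0 fF.
rewrite derive1nS derive1E.
by have [_ ->] := is_derive_halfline_eq IH x0 (cF n x x0).
Qed.

(** The operators 1 + D = e^(-x) D e^x, D - 1 = e^x D e^(-x) and multiplication by x (by the Leibniz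
    rule), acting on whole families of derivatives. *)
Definition chain_addD F i x := F i x + F i.+1 x.
Definition chain_subD F i x := F i.+1 x - F i x.
Definition chain_mulX F i x := x * F i x + i%:R * F i.-1 x.

Lemma deriv_chain_addD F : deriv_chain F -> deriv_chain (chain_addD F).
Proof. by move=> cF i x x0; apply: is_deriveD; exact: cF. Qed.

Lemma deriv_chain_subD F : deriv_chain F -> deriv_chain (chain_subD F).
Proof. by move=> cF i x x0; apply: is_deriveB; exact: cF. Qed.

Lemma deriv_chain_iter_addD F i : deriv_chain F -> deriv_chain (iter i chain_addD F).
Proof. by move=> cF; elim: i => //= i; exact: deriv_chain_addD. Qed.

Lemma deriv_chain_iter_subD F i : deriv_chain F -> deriv_chain (iter i chain_subD F).
Proof. by move=> cF; elim: i => //= i; exact: deriv_chain_subD. Qed.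

Lemma deriv_chain_mulX F : deriv_chain F -> deriv_chain (chain_mulX F).
Proof.
move=> cF i x x0; have di := cF i x x0.
have d1 := is_deriveM (is_derive_id x (1 : R)) di.
case: i di d1 => [|i] di d1.
  have e : chain_mulX F 0 = (fun z => z * F 0%N z).
    by apply/funext => z; rewrite /chain_mulX mul0r addr0.
  rewrite e; apply: (is_derive_eq d1).
  by rewrite /chain_mulX/= /GRing.scale/=; ring.
have d2 := is_deriveM (is_derive_cst (i.+1%:R : R) x 1) (cF i x x0).
apply: (is_derive_eq (is_deriveD d1 d2)).
by rewrite /chain_mulX/= /GRing.scale/= /cst -[i.+2]addn1 natrD; ring.
Qed.

Lemma deriv_chain_iter_mulX F i : deriv_chain F -> deriv_chain (iter i chain_mulX F).
Proof. by move=> cF; elim: i => //= i; exact: deriv_chain_mulX. Qed.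

Lemma deriv_chain_expR F : deriv_chain F ->
  deriv_chain (fun i x => expR x * iter i chain_addD F 0 x).
Proof.
move=> cF i x x0; have cS := @deriv_chain_iter_addD F i cF.
apply: (is_derive_eq (is_deriveM (is_derive_expR x) (cS 0%N x x0))).
by rewrite /= {3}/chain_addD /GRing.scale/=; ring.
Qed.

Lemma deriv_chain_expRN F : deriv_chain F ->
  deriv_chain (fun i x => expR (- x) * iter i chain_subD F 0 x).
Proof.
move=> cF i x x0; have cS := @deriv_chain_iter_subD F i cF.
have de := @is_derive1_comp _ expR -%R x _ _ (is_derive_expR _) (is_deriveNid x (1 : R)).
apply: (is_derive_eq (is_deriveM de (cS 0%N x x0))).
by rewrite /= {3}/chain_subD /GRing.scale/=; ring.
Qed.

(** (1 + D)^k commutes with D^n. *)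
Lemma iter_addD_shift F k n i x :
  iter k chain_addD F (n + i)%N x = iter k chain_addD (fun i => F (n + i)%N) i x.
Proof. by elim: k i => //= k IH i; rewrite /chain_addD -addnS !IH. Qed.

Lemma iter_addDZ F (c : R) k i x :
  iter k chain_addD (fun i x => c * F i x) i x = c * iter k chain_addD F i x.
Proof. by elim: k i => //= k IH i; rewrite /chain_addD !IH mulrDr. Qed.

End DerivChain.

Section RiemannLiouville.
Context {R : realType}.
Local Notation mu := (@lebesgue_measure R).
Local Notation H := (`]0, +oo[%classic : set R).
Implicit Types (x y : R) (m n i j : nat).

Let mH : measurable (H : set (measurableTypeR R)). Proof. exact: measurable_itv. Qed.
Hint Resolve mH : core.

Let HP x : H x = (0 < x) :> Prop.
Proof. by rewrite /= in_itv/= andbT. Qed.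

(** The tail is the full integral minus the integral over ]0, v], to which the fundamental theorem
    applies. *)
Lemma is_derive_tail_integral (h : R -> R) x : mu.-integrable H (EFin \o h) ->
  (forall y, 0 < y -> {for y, continuous h}) -> 0 < x ->
  is_derive x 1 (fun v => \int[mu]_(y in `[v, +oo[) h y) (- h x).
Proof.
move=> inth ch x0.
pose F v := \int[mu]_(y in `]0, v]) h y.
have intS (i : interval R) : [set` i] `<=` H -> mu.-integrable [set` i] (EFin \o h).
  by move=> iH; apply: integrableS inth => //; exact: measurable_itv.
apply: (@is_derive_halfline_eq _ _ (fun v => \int[mu]_(y in H) h y - F v)) => //.
  move=> v v0; rewrite /F Rintegral_itvB// ?bnd_simp//.
    rewrite Rintegral_itv_obnd_cbnd//; apply: intS => y.
    by rewrite HP /= in_itv/= andbT; exact: lt_trans.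
  exact: ltW.
have [dF F'] : derivable F x 1 /\ derive1 F x = h x.
  apply: (@continuous_FTC1 _ _ (BRight 0) x (x + 1)) => //.
  - by rewrite ltrDl.
  - by apply: intS => y; rewrite HP /= in_itv/= => /andP[].
  - exact: ch.
have {}dF : is_derive x 1 F (h x) by apply: (DeriveDef dF); rewrite -derive1E.
apply: (is_derive_eq (is_deriveB (is_derive_cst (\int[mu]_(y in H) h y) x (1 : R)) dF)).
by rewrite sub0r.
Qed.

Section Chain.
Variable f : R -> R.
Hypothesis intf : forall j, mu.-integrable H (EFin \o (fun y => y ^+ j * f y)).
Hypothesis cf : forall y, 0 < y -> {for y, continuous f}.

Let M j v := \int[mu]_(y in `[v, +oo[) (y ^+ j * f y).
Let Phi m v := \int[mu]_(y in `[v, +oo[) ((y - v) ^+ m * f y).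

Let dM j x : 0 < x -> is_derive x 1 (M j) (- (x ^+ j * f x)).
Proof.
move=> x0; apply: (@is_derive_tail_integral (fun y => y ^+ j * f y)) => // y y0.
by apply: cvgM; [exact: exprn_continuous|exact: cf].
Qed.

Let intS j x : 0 < x -> mu.-integrable `[x, +oo[ (EFin \o (fun y => y ^+ j * f y)).
Proof.
move=> x0; apply: integrableS (intf j) => //.
by move=> y; rewrite HP /= in_itv/= andbT; exact: lt_le_trans.
Qed.

(** Expanding the kernel takes x out of the integrand, leaving finitely many tail integrals [M j]
    with known derivatives. *)
Let PhiE m x : 0 < x ->
  Phi m x = \sum_(j < m.+1) ('C(m, j)%:R * (- x) ^+ (m - j) * M j x).
Proof.
move=> x0; have mx : measurable (`[x, +oo[ : set (measurableTypeR R)) by exact: measurable_itv.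
transitivity (\int[mu]_(y in `[x, +oo[) (\sum_(j < m.+1)
    'C(m, j)%:R * (- x) ^+ (m - j) * (y ^+ j * f y))).
  apply: eq_Rintegral => y _; rewrite addrC exprDn mulr_suml.
  by apply: eq_bigr => j _; rewrite -mulr_natl !mulrA.
rewrite Rintegral_sum//; last first.
  by move=> j; apply: integrableZl_EFin => //; exact: intS.
by apply: eq_bigr => j _; rewrite RintegralZl//; exact: intS.
Qed.

Let dPhi0 x : 0 < x -> is_derive x 1 (Phi 0) (- f x).
Proof.
move=> x0; have := dM 0 x0; rewrite expr0 mul1r.
have -> // : M 0 = Phi 0.
by apply/funext => v; apply: eq_Rintegral => y _; rewrite !expr0.
Qed.

Let dPhiS m x : 0 < x -> is_derive x 1 (Phi m.+1) (- (m.+1%:R * Phi m x)).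
Proof.
move=> x0; apply: (is_derive_halfline_eq (PhiE m.+1)) => //.
have dX i : is_derive x 1 (fun v => (- v) ^+ i) (- (i%:R * (- x) ^+ i.-1)).
  have := is_deriveX i (is_deriveNid x (1 : R)); rewrite exprfctE => /is_derive_eq; apply.
  by rewrite /GRing.scale/=; ring.
pose T (j : 'I_m.+2) (v : R) : R := 'C(m.+1, j)%:R * (- v) ^+ (m.+1 - j) * M j v.
pose T' (j : 'I_m.+2) : R := - ('C(m.+1, j)%:R * (m.+1 - j)%:R * (- x) ^+ (m - j) * M j x)
  - f x * ((- x) ^+ (m.+1 - j) * x ^+ j *+ 'C(m.+1, j)).
have dT (j : 'I_m.+2) : is_derive x 1 (T j) (T' j).
  have d1 := is_deriveM (is_derive_cst ('C(m.+1, j)%:R : R) x (1 : R)) (dX (m.+1 - j)%N).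
  apply: (is_derive_eq (is_deriveM d1 (dM j x0))).
  by rewrite /T' /GRing.scale !fctE predn_sub/= -[X in _ = _ - _ * X]mulr_natl; ring.
have := is_derive_sum dT.
have -> : \sum_(j < m.+2) T j = fun v => \sum_(j < m.+2) T j v.
  by apply/funext => v; rewrite fct_sumE.
move/is_derive_eq; apply.
(* The contributions of the moving endpoint add up to f(x) (- x + x)^(m+1) = 0. *)
rewrite /T' sumrB -mulr_sumr -exprDn addNr expr0n mulr0 subr0 sumrN PhiE//.
congr (- _); rewrite big_ord_recr/= subnn mulr0 !mul0r addr0 mulr_sumr.
apply: eq_bigr => j _; rewrite !mulrA -!natrM mulnC.
by have := mul_bin_down m.+1 j; rewrite /= => ->.
Qed.

Variable fc : nat -> R -> R.
Hypothesis cfc : deriv_chain fc.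
Hypothesis fE : forall x, 0 < x -> f x = fc 0 x.

(** The i-th derivative of I_-^n f: it is (-1)^i I_-^(n-i) f for i < n, and (-1)^n times a
    derivative of f afterwards. The factorial is Gamma(n-i). *)
Definition RLchain n i x := if (i < n)%N
  then (-1) ^+ i / (n - i).-1`!%:R * \int[mu]_(y in `[x, +oo[) ((y - x) ^+ (n - i).-1 * f y)
  else (-1) ^+ n * fc (i - n) x.

Lemma deriv_chain_RL n : (0 < n)%N -> deriv_chain (RLchain n).
Proof.
move=> n0 i x x0; rewrite /RLchain.
have [i1n|ni1|ni1] := ltngtP i.+1 n.
- have e : ((n - i).-1 = (n - i.+1).-1.+1)%N by lia.
  rewrite e; apply: (is_derive_eq (is_derive_cstM _ (dPhiS (n - i.+1).-1 x0))).
  rewrite factS natrM exprS.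
  have f0 : (((n - i.+1).-1)`!%:R : R) != 0 by rewrite pnatr_eq0 -lt0n fact_gt0.
  by rewrite /Phi; field; rewrite f0 ?natr1 ?nat1r pnatr_eq0.
- have -> : (i.+1 - n = (i - n).+1)%N by lia.
  exact: is_derive_cstM (cfc (i - n)%N x0).
(* At i + 1 = n the kernel is constant, and differentiation lands on the first member of [fc]. *)
- have -> : ((n - i).-1 = 0)%N by lia.
  rewrite -ni1 subnn fact0 divr1.
  apply: (is_derive_eq (is_derive_cstM _ (dPhi0 x0))).
  by rewrite fE// exprS; ring.
Qed.

End Chain.

Lemma RLintE (f : R -> R) fc n x : (0 < n)%N -> RLint n f x = RLchain f fc n 0 x.
Proof.
case: n => // n _; rewrite /RLint /RLchain GammaS subn0 /=.
by rewrite expr0 mul1r.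
Qed.

End RiemannLiouville.

(** * The terms of the Rodrigues formula *)

Section Rodrigues.
Context {R : realType}.
Local Notation mu := (@lebesgue_measure R).
Local Notation H := (`]0, +oo[%classic : set R).
Implicit Types (nu x : R) (j k n r : nat).

Let g nu x j : R := x ^+ j * rho (nu - j%:R) x / j`!%:R.
Let W nu k x := bintr (g nu x) k.

Let f0 j : (j`!%:R : R) != 0.
Proof. by rewrite pnatr_eq0 -lt0n fact_gt0. Qed.

Let gE nu x j : 0 < x -> x * g nu x j =
  (nu - j%:R - 1) * j.+1%:R * g nu x j.+1 + j.+1%:R * j.+2%:R * g nu x j.+2.
Proof.
move=> x0; have := rho_rec (nu - j%:R - 1) x0; rewrite subrK => e.
rewrite /g e !factS !natrM !exprS.
have -> : nu - j.+1%:R = nu - j%:R - 1 by rewrite -addn1 natrD; ring.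
have -> : nu - j.+2%:R = nu - j%:R - 1 - 1 by rewrite -addn2 natrD; ring.
have F0 := f0 j; have A0 : (j.+1%:R : R) != 0 by rewrite pnatr_eq0.
have B0 : (j.+2%:R : R) != 0 by rewrite pnatr_eq0.
set c := nu - j%:R - 1; move: F0 A0 B0 (rho c x) (rho (c - 1) x) (x ^+ j).
move: (j`!%:R : R) (j.+1%:R : R) (j.+2%:R : R) c => F A B c F0 A0 B0 r1 r2 y.
by field; rewrite F0 A0 B0.
Qed.

(** What is recorded is theta g_j = x g_j', because it stays in the span of the g_i. *)
Let dg nu x j : 0 < x -> exists2 d, is_derive x 1 (g nu ^~ j) d &
  x * d = j%:R * g nu x j - j.+1%:R * g nu x j.+1.
Proof.
move=> x0; have dX : is_derive x 1 (fun v => v ^+ j) (j%:R * x ^+ j.-1).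
  have := is_deriveX j (is_derive_id x (1 : R)); rewrite exprfctE => /is_derive_eq; apply.
  by rewrite /GRing.scale/=; ring.
have d1 := is_deriveM dX (is_derive_rho (nu - j%:R) x0).
exists (j`!%:R^-1 * (x ^+ j * - rho (nu - j%:R - 1) x + rho (nu - j%:R) x * (j%:R * x ^+ j.-1))).
  have -> : (g nu ^~ j) = fun v => j`!%:R^-1 * (v ^+ j * rho (nu - j%:R) v).
    by apply/funext => v; rewrite /g mulrC.
  exact: is_derive_cstM d1.
have -> : x * (j`!%:R^-1 * (x ^+ j * - rho (nu - j%:R - 1) x + rho (nu - j%:R) x * (j%:R * x ^+ j.-1)))
  = j`!%:R^-1 * (j%:R * (x * x ^+ j.-1)) * rho (nu - j%:R) x - j`!%:R^-1 * (x * x ^+ j) * rho (nu - j%:R - 1) x.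
  by ring.
have -> : j%:R * (x * x ^+ j.-1) = j%:R * x ^+ j.
  by case: (j) => [|i]; rewrite ?mul0r// -exprS.
rewrite /g factS natrM exprS.
have -> : nu - j.+1%:R = nu - j%:R - 1 by rewrite -addn1 natrD; ring.
have F0 := f0 j; have A0 : (j.+1%:R : R) != 0 by rewrite pnatr_eq0.
move: F0 A0; move: (j`!%:R : R) (j.+1%:R : R) => F A F0 A0.
by field; rewrite F0 A0.
Qed.

Let dW nu k x : 0 < x -> exists2 d, is_derive x 1 (W nu k) d &
  x * d = k.+1%:R * (W nu k.+1 x - W nu k x).
Proof.
move=> x0; have dgx j := cid2 (@dg nu x j x0).
pose d j := projT1 (dgx j).
exists (bintr d k).
  have -> : W nu k = \sum_(j < k.+1) (fun z => (-1) ^+ j * 'C(k, j)%:R * g nu z j).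
    by apply/funext => z; rewrite fct_sumE.
  apply: is_derive_sum => j; apply: is_derive_cstM.
  by rewrite /d; case: (dgx j).
rewrite -bintrZ (eq_bintr (g2 := fun j => j%:R * g nu x j + (-1) * (j.+1%:R * g nu x j.+1))); last first.
  by move=> j; rewrite /d; case: (dgx j) => /= e _ ->; ring.
rewrite bintrD bintrZ (bintr_shift (fun j => j%:R * g nu x j)).
have := @bintr_mul R (g nu x) k.+1; rewrite /= -/(W nu k.+1 x) -/(W nu k x) => <-.
by ring.
Qed.

Let rhoc nu j x : R := (-1) ^+ j * rho (nu - j%:R) x.

Let chain_rhoc nu : deriv_chain (rhoc nu).
Proof.
move=> j x x0; apply: (is_derive_eq (is_derive_cstM _ (is_derive_rho _ x0))).
rewrite /rhoc exprS -natr1.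
have -> : nu - (j%:R + 1) = nu - j%:R - 1 by ring.
by ring.
Qed.

Let hc nu k := iter k chain_mulX (rhoc nu).

Let chain_hc nu k : deriv_chain (hc nu k).
Proof. exact/deriv_chain_iter_mulX/chain_rhoc. Qed.

Let hc0 nu k x : hc nu k 0 x = x ^+ k * rho nu x.
Proof.
elim: k => [|k IH]; first by rewrite /hc/= /rhoc subr0; ring.
by rewrite /hc /= {1}/chain_mulX -/(hc nu k) IH exprS; ring.
Qed.

(** By Leibniz, D^(k+1) (x^(k+1) rho_nu) = (theta + k + 1) D^k (x^k rho_nu), and [dW] gives (theta +
    k + 1) W_k = (k+1) W_{k+1}. *)
Let hcW nu k x : 0 < x -> hc nu k k x = k`!%:R * W nu k x.
Proof.
elim: k x => [|k IH] x x0.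
  by rewrite hc0 /W /bintr big_ord1 /g subr0 fact0 bin0; field.
rewrite /hc/= {1}/chain_mulX/= -/(hc nu k) IH//.
have [d dWx xd] := @dW nu k x x0.
rewrite -(deriv_chain_uniq (@chain_hc nu k) _ x0 (is_derive_cstM (k`!%:R) dWx)); last first.
  by move=> z z0; rewrite IH.
by rewrite mulrCA xd factS natrM; ring.
Qed.

Let fc nu k i x := expR (- x) * iter i chain_subD (hc nu k) 0 x.

Let chain_fc nu k : deriv_chain (fc nu k).
Proof. exact/deriv_chain_expRN/chain_hc. Qed.

Lemma rodrigues_termE nu n k x : -1 < nu -> (0 < n)%N -> 0 < x ->
  rodrigues_term nu n k x = (-1) ^+ n / rho nu x *
    (k`!%:R * bintr (fun j => x ^+ j * rho (nu - j%:R) x / j`!%:R) k).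
Proof.
move=> nu1 n0 x0; pose f y : R := y ^+ k * expR (- y) * rho nu y.
have fE y : f y = fc nu k 0 y by rewrite /fc /= hc0 /f; ring.
have intf j : mu.-integrable H (EFin \o (fun y => y ^+ j * f y)).
  have mH : measurable (H : set (measurableTypeR R)) by exact: measurable_itv.
  apply: eq_integrable_EFin (integrable_moment (j + k) nu1) => // y _.
  by rewrite /f exprD; ring.
have cf y : 0 < y -> {for y, continuous f}.
  move=> y0; rewrite (_ : f = fc nu k 0); last exact/funext.
  exact: is_derive_continuous (@chain_fc nu k 0%N y y0).
pose RL := RLchain f (fc nu k) n.
have cRL : deriv_chain RL.
  exact: (deriv_chain_RL intf cf (@chain_fc nu k) (fun y _ => fE y) n0).
have inner u : 0 < u -> derive1n k (fun v => expR v * RLint n f v) u =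
    expR u * iter k chain_addD RL 0 u.
  move=> u0.
  apply: (@derive1n_chain _ (fun i x => expR x * iter i chain_addD RL 0 x)) => //.
    exact: deriv_chain_expR.
  by move=> v v0; rewrite (RLintE f (fc nu k)).
(* The exponentials cancel and D^n (1 + D)^k I_-^n f remains. *)
have outer : derive1n n (fun u => expR (- u) * derive1n k (fun v => expR v * RLint n f v) u) x
    = iter k chain_addD RL n x.
  apply: (@derive1n_chain _ (iter k chain_addD RL)) => //.
    exact: deriv_chain_iter_addD.
  move=> u u0.
  by rewrite inner// mulrA -expRD addNr expR0 mul1r.
(* Only members of index at least n occur, where [RL] is (-1)^n times [fc]. *)
have shift : iter k chain_addD RL n x = (-1) ^+ n * iter k chain_addD (fc nu k) 0 x.
  rewrite -[n in LHS]addn0 iter_addD_shift -iter_addDZ; congr (iter _ _ _ _ _).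
  by apply/funext => i; apply/funext => y; rewrite /RL /RLchain ltnNge leq_addr/= addKn.
(* One k-th derivative is computed along two families, since e^y f(y) = y^k rho_nu(y). *)
have hck : expR x * iter k chain_addD (fc nu k) 0 x = hc nu k k x.
  transitivity (derive1n k (fun y => expR y * f y) x).
    apply/esym; apply: (@derive1n_chain _ (fun i x => expR x * iter i chain_addD (fc nu k) 0 x)) => //.
      exact: deriv_chain_expR (@chain_fc nu k).
    by move=> y _; rewrite fE.
  apply: derive1n_chain => // y _; rewrite hc0.
  transitivity (expR y * expR (- y) * (y ^+ k * rho nu y)); first by rewrite /f; ring.
  by rewrite -expRD subrr expR0 mul1r.
rewrite /rodrigues_term outer shift -/(g nu x) -/(W nu k x) -hcW// -hck.
by ring.
Qed.

(** The expansion of x^r rho_nu divided by rho_nu; the k! of [rodrigues_termE] cancels the weight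
    1/k!. *)
Lemma sum_rodrigues_term nu n r x : -1 < nu -> (0 < n)%N -> 0 < x ->
  r`!%:R * pochhammer (1 + nu) r * \sum_(k < (2 * r).+1) (k`!%:R^-1 *
    hyper3F2 (- k%:R) (1 + nu + r%:R) (1 + r%:R) (1 + nu) 1 1 * rodrigues_term nu n k x) =
  (-1) ^+ n * x ^+ r.
Proof.
move=> nu1 n0 x0; have r0 := rho_gt0 nu x0.
have -> : x ^+ r = (rho nu x)^-1 * (x ^+ r * g nu x 0).
  by rewrite /g subr0 fact0 expr0; field; rewrite gt_eqF.
rewrite -(@sum_bintr_pochhammer _ nu x (g nu x) _ r (2 * r).+1)//; last first.
  by move=> j; exact: gE.
rewrite !mulr_sumr; apply: eq_bigr => k _.
rewrite rodrigues_termE// -(hyper3F2_bintr k r nu1) -/(g nu x).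
have K0 := f0 k; have r0' : rho nu x != 0 by rewrite gt_eqF.
move: K0 r0'; move: (k`!%:R : R) (rho nu x) (hyper3F2 _ _ _ _ _ _) (bintr _ _) => K rh h b K0 r0'.
by field; rewrite K0 r0'.
Qed.

End Rodrigues.

(** * Orthogonality and Cramer's rule *)

Section Orthogonality.
Context {R : realType} (nu : R) (hnu : -1 < nu).
Local Notation mu := (@lebesgue_measure R).
Local Notation H := (`]0, +oo[%classic : set R).
Local Notation w := (fun x : R => expR (- x) * rho nu x).
Implicit Types (p q : {poly R}) (m n N : nat).

Let mH : measurable (H : set (measurableTypeR R)). Proof. exact: measurable_itv. Qed.
Hint Resolve mH : core.

Let HP (x : R) : H x = (0 < x) :> Prop.
Proof. by rewrite /= in_itv/= andbT. Qed.

Let w_gt0 x : 0 < x -> 0 < w x.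
Proof. by move=> x0; rewrite mulr_gt0 ?expR_gt0 ?rho_gt0. Qed.

Let L p := \int[mu]_(x in H) (p.[x] * w x).

Let integrableL p : mu.-integrable H (EFin \o (fun x => p.[x] * w x)).
Proof.
have intS : mu.-integrable H (EFin \o
    (fun x => \sum_(i < size p) p`_i * (x ^+ i * w x))).
  apply: integrable_sum_EFin => // i; apply: integrableZl_EFin => //.
  exact: integrable_moment.
apply: eq_integrable_EFin intS => // x _.
rewrite /= horner_coef mulr_suml; apply: eq_bigr => i _; ring.
Qed.

Let LD p q : L (p + q) = L p + L q.
Proof.
rewrite /L -RintegralD//; apply: eq_Rintegral => x _.
by rewrite hornerD mulrDl.
Qed.

Let LZ (a : R) p : L (a *: p) = a * L p.
Proof.
rewrite /L -RintegralZl//; apply: eq_Rintegral => x _.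
by rewrite hornerZ; ring.
Qed.

Let L0 : L 0 = 0.
Proof. by have := LZ 0 0; rewrite scale0r mul0r. Qed.

Let L_sum I (r : seq I) (F : I -> {poly R}) : L (\sum_(i <- r) F i) = \sum_(i <- r) L (F i).
Proof.
elim: r => [|i r IH]; first by rewrite !big_nil L0.
by rewrite !big_cons LD IH.
Qed.

Let LXn n : L 'X^n = moment nu n.
Proof. by apply: eq_Rintegral => x _; rewrite hornerXn. Qed.

Let LM p q N : (size q <= N)%N -> L (p * q) = \sum_(i < N) q`_i * L (p * 'X^i).
Proof.
move=> qN; have {1}-> : q = \sum_(i < N) q`_i *: 'X^i.
  rewrite -poly_def; apply/polyP => i; rewrite coef_poly; case: ltnP => // Ni.
  by rewrite nth_default// (leq_trans qN).
rewrite mulr_sumr L_sum; apply: eq_bigr => i _.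
by rewrite -scalerAr LZ.
Qed.

Let LMXn p N m : (size p <= N)%N ->
  L (p * 'X^m) = \sum_(i < N) p`_i * moment nu (m + i).
Proof.
move=> pN; rewrite mulrC (LM _ pN); apply: eq_bigr => i _.
by rewrite -exprD LXn.
Qed.

Let L_sqr_ge0 p : 0 <= L (p * p).
Proof.
apply: Rintegral_ge0 => x; rewrite HP => x0.
by rewrite hornerM mulr_ge0 ?(ltW (w_gt0 x0))// -expr2 sqr_ge0.
Qed.

Let L_X_sqr p : L ('X * (p * p)) = 0 -> L (p * p) = 0.
Proof.
move=> /(Rintegral_eq0_ae (integrableL _)) ae0.
rewrite /L /Rintegral (ae_eq_integral (cst 0%E))//; first by rewrite integral0.
  by have /integrableP[] := integrableL (p * p).
have {}ae0 := ae0 _; apply: filterS (ae0 _) => [x + Hx|x x0].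
  move=> /(_ Hx) /= [] /eqP; rewrite hornerM hornerX -mulrA mulf_eq0.
  by rewrite gt_eqF/= -?HP// => /eqP ->.
rewrite hornerM hornerX hornerM mulr_ge0 ?(ltW (w_gt0 x0))// mulr_ge0 ?(ltW x0)//.
by rewrite -expr2 sqr_ge0.
Qed.

Variable P : nat -> {poly R}.
Hypothesis hP : orthonormal_polys w P.

Let LPP m n : L (P m * P n) = (m == n)%:R.
Proof.
have [_ <-] := hP; apply: eq_Rintegral => x _.
by rewrite hornerM.
Qed.

Let sizeP n : size (P n) = n.+1. Proof. by have [/(_ n)[]] := hP. Qed.

Let leadP n : 0 < (P n)`_n.
Proof. by have [/(_ n)[sP]] := hP; rewrite lead_coefE sP. Qed.

Let divP q n : (size q <= n.+1)%N ->
  exists c q', [/\ (size q' <= n)%N & q = c *: P n + q'].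
Proof.
move=> qn; exists (q`_n / (P n)`_n), (q - (q`_n / (P n)`_n) *: P n).
split; last by rewrite addrC subrK.
apply/leq_sizeP => j nj; rewrite coefB coefZ.
have [->|jn] := eqVneq j n; first by rewrite divfK ?subrr// gt_eqF.
have nj' : (n < j)%N by rewrite ltn_neqAle eq_sym jn.
rewrite [q`_j]nth_default ?(leq_trans qn)// [(P n)`_j]nth_default ?sizeP//.
by rewrite mulr0 subrr.
Qed.

Let orthP n q : (size q <= n)%N -> L (P n * q) = 0.
Proof.
suff main k : (k <= n)%N -> forall q, (size q <= k)%N -> L (P n * q) = 0 by exact: main.
elim: k => [|k IH] kn {}q qk.
  by move: qk; rewrite leqn0 size_poly_eq0 => /eqP ->; rewrite mulr0 L0.
have [c [q' [q'k ->]]] := divP qk.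
rewrite mulrDr LD -scalerAr LZ LPP IH// ?(ltnW kn)//.
by rewrite gtn_eqF// mulr0 addr0.
Qed.

(** Writing q = c P_k + q' gives L(q^2) = c^2 + L(q'^2), so definiteness follows from orthonormality
    by induction on the degree. *)
Let L_sqr_eq0 q : L (q * q) = 0 -> q = 0.
Proof.
suff main k : forall q, (size q <= k)%N -> L (q * q) = 0 -> q = 0 by exact: main.
elim: k => [|k IH] {}q qk; first by move: qk; rewrite leqn0 size_poly_eq0 => /eqP.
have [c [q' [q'k ->]]] := divP qk.
rewrite mulrDl !mulrDr !LD -!scalerAl -!scalerAr !LZ LPP eqxx.
rewrite [q' * P k]mulrC (orthP q'k) => e; have q'0 := L_sqr_ge0 q'.
have {e} e0 : c ^+ 2 + L (q' * q') = 0 by rewrite -[RHS]e /=; ring.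
have c0 : c = 0 by apply/eqP; rewrite -sqrf_eq0; apply/eqP; have := sqr_ge0 c; lra.
rewrite c0 scale0r add0r; apply: IH => //.
by move: e0; rewrite c0 expr0n add0r.
Qed.

Let Gamma0 : 0 < Gamma (1 + nu). Proof. by apply: Gamma_gt0; have := hnu; lra. Qed.

Let sumd p n m : (size p <= n)%N -> \sum_(k < n) p`_k * dcoef nu k m =
  Gamma (1 + nu) / m`!%:R * L (p * 'X^m).
Proof.
move=> pn; rewrite (LMXn _ pn) mulr_sumr; apply: eq_bigr => k _.
by rewrite dcoef_moment//; ring.
Qed.

Let fneq0 m : (m`!%:R : R) != 0. Proof. by rewrite pnatr_eq0 -lt0n fact_gt0. Qed.

(** A kernel vector is the coefficient list of some q of degree below n with L(x q x^m) = 0 for m <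
    n; the extra x appears because the columns start at d_{1,m}. Testing against q itself gives L(x
    q^2) = 0, hence q = 0. *)
Lemma Ddet_neq0 n : Ddet nu n != 0.
Proof.
apply/negP; rewrite /Ddet -det_tr => /det0P[v v0 vA].
pose q := \poly_(i < n) (if insub i is Some j then v 0 j else 0).
have qE (j : 'I_n) : q`_j = v 0 j by rewrite coef_poly ltn_ord valK.
have Lq m : (m < n)%N -> L ('X * q * 'X^m) = 0.
  move=> mn; have /matrixP/(_ 0 (Ordinal mn)) := vA; rewrite !mxE.
  have := @sumd ('X * q) n.+1 m; rewrite big_ord_recl coefXM/= mul0r add0r => e sv.
  have : Gamma (1 + nu) / m`!%:R * L ('X * q * 'X^m) = 0.
    rewrite -e.
      rewrite -[RHS]sv; apply: eq_bigr => j _; rewrite !mxE coefXM/= -qE.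
      by rewrite /bump/= add1n.
    by rewrite (leq_trans (size_polyMleq _ _))// size_polyX/= ltnS size_poly.
  move/eqP; rewrite mulf_eq0 mulf_eq0 invr_eq0 (negbTE (fneq0 m)) gt_eqF//=.
  by move/eqP.
have : q = 0.
  apply/L_sqr_eq0/L_X_sqr; rewrite mulrA (LM _ (size_poly _ _)).
  by rewrite big1// => i _; rewrite Lq ?mulr0.
move=> q0; move/eqP: v0; apply; apply/rowP => j.
by rewrite -qE q0 coef0 mxE.
Qed.

(** Orthogonality to x^m for m < n is a linear system for a_{n,1}, ..., a_{n,n}, multiplied here by
    the adjugate. The case k = 0 is the convention D_{n,0} = - D_n. *)
Lemma orthonormal_coef_Cramer n k : (k <= n)%N ->
  Ddet nu n * (P n)`_k = - (P n)`_0 * Ddet_repl nu n k.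
Proof.
case: k => [|k] kn; first by rewrite /Ddet_repl/=; ring.
pose A : 'M[R]_n := \matrix_(m < n, j < n) dcoef nu j.+1 m.
pose a : 'cV[R]_n := \col_j (P n)`_j.+1.
pose b : 'cV[R]_n := \col_m (- (P n)`_0 * dcoef nu 0 m).
have Aa : A *m a = b.
  apply/colP => m; rewrite !mxE.
  have := @sumd (P n) n.+1 m; rewrite sizeP leqnn => /(_ isT).
  rewrite orthP ?size_polyXn// mulr0 big_ord_recl => /eqP; rewrite addrC addr_eq0 => /eqP e.
  by rewrite mulNr -e; apply: eq_bigr => j _; rewrite !mxE mulrC.
pose k' := Ordinal kn.
have : (\adj A *m (A *m a)) k' 0 = (\adj A *m b) k' 0 by rewrite Aa.
rewrite mulmxA mul_adj_mx mul_scalar_mx !mxE -/(Ddet nu n) => ->.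
rewrite /Ddet_repl/= (expand_det_col _ k') mulr_sumr; apply: eq_bigr => m _.
rewrite !mxE eqxx mulrC -mulrA; congr (_ * (_ * _)); rewrite /cofactor.
(* Cofactors along column [k'] do not see that column, so replacing it leaves them unchanged. *)
congr (_ * \det _); apply/matrixP => i j; rewrite !mxE.
case: ifP => // /eqP[] e.
have /eqP := val_inj (e : val (lift k' j) = val k').
by rewrite eq_sym (negbTE (neq_lift _ _)).
Qed.

(** By orthogonality L(P_n^2) = 1 becomes a_n sum_k a_k L(x^(n+k)) = 1. Cramer's rule is used for
    a_n and for each a_k, and (n+k)! d_{0,n+k} is Gamma(1+nu) times the moment. *)
Lemma orthonormal_norm n : (Ddet nu n) ^+ 2 * Gamma (1 + nu) =
  (P n)`_0 ^+ 2 * (Ddet_repl nu n n *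
    \sum_(k < n.+1) Ddet_repl nu n k * (n + k)`!%:R * dcoef nu 0 (n + k)).
Proof.
have e1 := LPP n n; move: e1; rewrite eqxx (@LM _ _ n.+1) ?sizeP// big_ord_recr/=.
rewrite big1 ?add0r => [|i _]; last by rewrite orthP ?mulr0// size_polyXn.
rewrite (@LMXn _ n.+1) ?sizeP// => e1.
have -> : \sum_(k < n.+1) Ddet_repl nu n k * (n + k)`!%:R * dcoef nu 0 (n + k) =
    \sum_(k < n.+1) Gamma (1 + nu) * (Ddet_repl nu n k * moment nu (n + k)).
  apply: eq_bigr => k _; rewrite dcoef_moment// addn0.
  rewrite -mulrA [X in _ * X](_ : _ = Gamma (1 + nu) * moment nu (n + k)); first by ring.
  by rewrite !mulrA [_ * Gamma _]mulrC mulfK.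
rewrite -mulr_sumr -[LHS]mulr1 -[X in _ * X]e1.
have -> : (P n)`_0 ^+ 2 * (Ddet_repl nu n n * (Gamma (1 + nu) *
      \sum_(k < n.+1) Ddet_repl nu n k * moment nu (n + k))) =
    Gamma (1 + nu) * (- (P n)`_0 * Ddet_repl nu n n) *
    \sum_(k < n.+1) (- (P n)`_0 * Ddet_repl nu n k) * moment nu (n + k).
  under [X in _ = _ * X]eq_bigr do rewrite -mulrA.
  by rewrite -mulr_sumr; ring.
rewrite -orthonormal_coef_Cramer//.
rewrite [X in _ = _ * X](_ : _ = \sum_(k < n.+1) Ddet nu n * ((P n)`_k * moment nu (n + k))).
  by rewrite -mulr_sumr; ring.
apply: eq_bigr => k _; have kn : (k <= n)%N by rewrite -ltnS.
by rewrite -(orthonormal_coef_Cramer kn) -mulrA.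
Qed.

(** Otherwise Cramer's rule would make the leading coefficient vanish. *)
Lemma orthonormal_coef0_neq0 n : (P n)`_0 != 0.
Proof.
apply/eqP => a0; have := orthonormal_coef_Cramer (leqnn n).
rewrite a0 oppr0 mul0r => /eqP; rewrite mulf_eq0 (negbTE (Ddet_neq0 n))/=.
by rewrite gt_eqF.
Qed.

End Orthogonality.

(** * The constant coefficient and the Rodrigues formula *)

Theorem theorem2 (R : realType) (nu : R) (hnu : -1 < nu)
  (P : nat -> {poly R})
  (hP : orthonormal_polys (fun x : R => expR (- x) * rho nu x) P)
  (n : nat) (hn : (1 <= n)%N) :
  (exists s : R, [/\ s = 1 \/ s = -1,
     (P n)`_0 = s * (Ddet nu n * Num.sqrt (Gamma (1 + nu) /
       (Ddet_repl nu n n *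
        \sum_(k < n.+1)
           Ddet_repl nu n k * ((n + k)`!)%:R * dcoef nu 0 (n + k)))) &
     0 < (P n)`_n]) /\
  (forall x : R, 0 < x ->
     (P n).[x] =
       (-1) ^+ n.+1 * (P n)`_0 / Ddet nu n *
       \sum_(r < n.+1)
          (Ddet_repl nu n r * (r`!)%:R * pochhammer (1 + nu) r *
           \sum_(k < (2 * r).+1)
              ((k`!)%:R^-1 *
               hyper3F2 (- k%:R) (1 + nu + r%:R) (1 + r%:R) (1 + nu) 1 1 *
               rodrigues_term nu n k x))).
Proof.
have Gam0 : 0 < Gamma (1 + nu) by apply: Gamma_gt0; have := hnu; lra.
have D0 := Ddet_neq0 hnu hP n; have a0 := orthonormal_coef0_neq0 hnu hP n.
have sP : size (P n) = n.+1 by have [/(_ n)[]] := hP.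
split.
  set a := (P n)`_0 in a0 *; set D := Ddet nu n in D0 *.
  set S := Ddet_repl nu n n * _.
  have norm : D ^+ 2 * Gamma (1 + nu) = a ^+ 2 * S := orthonormal_norm hnu hP n.
  have S0 : S != 0.
    apply/eqP => S0; move/eqP: norm; rewrite S0 mulr0 mulf_eq0 sqrf_eq0.
    by rewrite (negbTE D0) gt_eqF.
  have -> : Num.sqrt (Gamma (1 + nu) / S) = `|a / D|.
    rewrite -sqrtr_sqr; congr Num.sqrt; rewrite expr_div_n.
    by apply/eqP; rewrite eqr_div ?sqrf_eq0// mulrC norm.
  (* The square root is |a / D|, so the sign must be that of a / D, which is nonzero. *)
  exists (Num.sg (a / D)); split.
  - have aD : a / D != 0 by rewrite mulf_neq0 ?invr_eq0.
    by case: sgrP aD => // _ _; [left|right].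
  - by rewrite mulrCA -numEsg mulrC divfK.
  - by have [/(_ n)[_]] := hP; rewrite lead_coefE sP.
move=> x x0.
rewrite horner_coef sP.
rewrite [X in _ = _ * X](_ : _ = \sum_(r < n.+1) (-1) ^+ n * (Ddet_repl nu n r * x ^+ r)); last first.
  apply: eq_bigr => r _; rewrite -!mulrA [_ * (pochhammer _ _ * _)]mulrA.
  by rewrite (sum_rodrigues_term r hnu hn x0) mulrCA.
rewrite mulr_sumr; apply: eq_bigr => r _.
have rn : (r <= n)%N by rewrite -ltnS.
have -> : (P n)`_r = - (P n)`_0 * Ddet_repl nu n r / Ddet nu n.
  by rewrite -(orthonormal_coef_Cramer hnu hP rn) mulrC mulKf.
(* The (-1)^(n+1) of the prefactor and the (-1)^n of the Rodrigues sums leave the minus sign of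
   Cramer's rule. *)
have s1 : (-1) ^+ n * (-1) ^+ n = 1 :> R by rewrite -expr2 sqrr_sign.
transitivity (- ((-1) ^+ n * (-1) ^+ n) * (P n)`_0 * Ddet_repl nu n r / Ddet nu n * x ^+ r).
  by rewrite s1; ring.
by rewrite exprS; ring.
Qed.
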